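(* Let $i,j,k$ be fixed positive integers with $k\ge 2$, $j>k$ and $2\le i\le \binom{j}{k}$, such that $ki-j$ is not divisible by $i-1$. Then $$F^{(k)}(n; j, i) = \Omega\left(\left(n^{k\cdot i - j} \log n\right)^{\frac{1}{i-1}}\right)$$ as $n\to\infty$, where the implied constant may depend on $i,j,k$ but not on $n$.
   Context: $F^{(k)}(n; j, i)$ denotes the minimum number $m$ such that every $k$-uniform hypergraph on $n$ vertices with $m$ edges (no repeated edges) has a set of $j$ vertices spanning at least $i$ edges, i.e. a set of $j$ vertices containing at least $i$ edges of the hypergraph. *)

(* Defs.v *)
From mathcomp Require Import all_boot.

Set Implicit Arguments.
Unset Strict Implicit.
Unset Printing Implicit Defensive.

(* A hypergraph on n vertices is its set of edges, a set of subsets of 'I_n;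
   in particular no edge is repeated. *)
Definition uniform (k n : nat) (H : {set {set 'I_n}}) : bool :=
  [forall e in H, #|e| == k].

Definition has_dense_set (j i n : nat) (H : {set {set 'I_n}}) : bool :=
  [exists S : {set 'I_n}, (#|S| == j) && (i <= #|[set e in H | e \subset S]|)].

Definition forces_dense_set (k n j i m : nat) : bool :=
  [forall H : {set {set 'I_n}},
     uniform k H && (#|H| == m) ==> has_dense_set j i H].

(* No k-uniform hypergraph on n vertices has 'C(n, k) + 1 edges, so the minimum
   in [BES] is over a nonempty set for all values of the parameters. *)
Lemma forces_dense_set_ex (k n j i : nat) :
  exists m, forces_dense_set k n j i m.
Proof.
exists 'C(n, k).+1; apply/forallP => H; apply/implyP => /andP[/forall_inP Hk].
have : #|H| <= 'C(n, k).
  rewrite -[X in 'C(X, _)](card_ord n) -cardsT -cards_draws.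
  apply: subset_leq_card; apply/subsetP => e eH.
  by rewrite inE subsetT Hk.
by move=> + /eqP E; rewrite E ltnn.
Qed.

(* F^(k)(n; j, i), the Brown-Erdos-Sos function *)
Definition BES (k n j i : nat) : nat := ex_minn (forces_dense_set_ex k n j i).

(* Main.v *)
(* Write r = i - 1 and g = j - k. Sample the k-sets with density n ^ (eps - g / r)
   and delete an edge from each of the (few) constant-size families spanning too
   few vertices. A family of i edges on at most j vertices is then tight, and by
   submodularity of the span the minimal tight families form a hypergraph, whose
   vertices are the sampled k-sets, without Berge cycles of length 2, 3 or 4; as r
   does not divide g, all of them have at least three members. An independent set
   of this hypergraph with the logarithmic gain of Ajtai, Komlos, Pintz, Spencer
   and Szemeredi is found by a nibble: in each round select vertices at random at a
   low rate, and discard the vertices that would complete an edge, equalising the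
   survival probabilities by additional coin flips. Since there are no short cycles,
   the new degrees are sums of pairwise independent indicators and Chebyshev's
   inequality bounds all but a negligible part of them. *)
Require Import Defs.
From mathcomp Require Import all_boot all_order all_algebra.
From mathcomp Require Import ring lra zify.

Set Implicit Arguments.
Unset Strict Implicit.
Unset Printing Implicit Defensive.

Import Order.TTheory GRing.Theory Num.Theory.
Local Open Scope ring_scope.

(** * Random subsets *)

(** The density exceeds [n ^ (- g / r)] by [n ^ eps] so that degrees in the conflict hypergraph are
    polynomial in [n]: the nibble gains a power of the logarithm of the degree scale. The excess
    costs nothing in the end, as the sample has order [n ^ (k - g / r + eps)] members, the nibble
    keeps a share of order [(log n) ^ (1 / r) / n ^ eps], and [k * i - j = k * r - g]. The value
    [eps = 1 / (r V)] with [V = 4 (r + 1)] meets two needs. Excluding a cycle of length 4 takes the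
    union of four minimal tight families, so overdense families of up to [V] members must be
    destroyed. Overdensity is a strict inequality of integers and gains only [n ^ (- 1 / r)], which
    pays for at most [V] factors [n ^ eps]. The conflict hypergraph is not uniform, and each round
    leaves shrunken edges of various sizes. Edges of size 2 block vertices at first order in the
    selection rate, which is what the coins equalise; completion by larger edges is an error term.
    Cycles of length 4 matter because the survival of a neighbour of [v] depends on vertices two
    steps away from [v]. *)

Section RandomSubset.
Variables (R : realFieldType) (I : finType) (p : I -> R).

Definition prob_weight (w : {set I}) : R :=
  \prod_i (if i \in w then p i else 1 - p i).

Definition expect (f : {set I} -> R) : R := \sum_w prob_weight w * f w.

(** Indicator of a cylinder event: coordinates in [O] are 1, those in [Z] are 0. Products of
    cylinders are cylinders, and disjoint supports give independence. *)
Definition cyl (O Z w : {set I}) : R := ((O \subset w) && [disjoint Z & w])%:R.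

Lemma cyl_ge0 O Z w : 0 <= cyl O Z w.
Proof. exact: ler0n. Qed.

Lemma cylM O Z O' Z' w :
  cyl O Z w * cyl O' Z' w = cyl (O :|: O') (Z :|: Z') w.
Proof.
rewrite /cyl -natrM mulnb subUset; congr (nat_of_bool _)%:R.
by rewrite !disjoints_subset subUset andbACA.
Qed.

Lemma expect_ext f g : f =1 g -> expect f = expect g.
Proof. by move=> fg; apply: eq_bigr => w _; rewrite fg. Qed.

Lemma expectD f g : expect (fun w => f w + g w) = expect f + expect g.
Proof. by rewrite -big_split; apply: eq_bigr => w _; rewrite mulrDr. Qed.

Lemma expectZ c f : expect (fun w => c * f w) = c * expect f.
Proof. by rewrite [RHS]mulr_sumr; apply: eq_bigr => w _; rewrite mulrCA. Qed.

Lemma expectB f g : expect (fun w => f w - g w) = expect f - expect g.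
Proof. by rewrite -sumrB; apply: eq_bigr => w _; rewrite mulrBr. Qed.

Lemma expect_sum (J : finType) (P : pred J) (f : J -> {set I} -> R) :
  expect (fun w => \sum_(j | P j) f j w) = \sum_(j | P j) expect (f j).
Proof.
by rewrite [RHS]exchange_big; apply: eq_bigr => w _; rewrite mulr_sumr.
Qed.

Lemma expect_cyl (O Z : {set I}) : [disjoint O & Z] ->
  expect (cyl O Z) = (\prod_(i in O) p i) * \prod_(i in Z) (1 - p i).
Proof.
move=> dOZ.
(* Choices that violate the constraints get factor 0, so the cylinder is absorbed into the product
   weight and the sum over [w] factors by distributivity. *)
pose F i : R := if i \in Z then 0 else p i.
pose G i : R := if i \in O then 0 else 1 - p i.
have -> : expect (cyl O Z) = \prod_i (F i + G i).
  rewrite bigA_distr; apply: eq_bigr => w _; rewrite /cyl.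
  case: (boolP (O \subset w)) => [Ow | nOw] /=; last first.
    have [i iO niw] := subsetPn nOw.
    by rewrite mulr0 (bigD1 i) //= (negPf niw) /G iO mul0r.
  case: (boolP [disjoint Z & w]) => [dZ | ndZ]; last first.
    move: ndZ; rewrite -setI_eq0 => /set0Pn[i /setIP[iZ iw]].
    by rewrite mulr0 (bigD1 i) //= iw /F iZ mul0r.
  rewrite mulr1; apply: eq_bigr => i _; rewrite /F /G.
  case: (boolP (i \in w)) => iw.
    by case: (boolP (i \in Z)) => // /(disjointFr dZ); rewrite iw.
  by case: (boolP (i \in O)) => // /(subsetP Ow); rewrite (negPf iw).
rewrite [X in X * _]big_mkcond [X in _ * X]big_mkcond -big_split.
apply: eq_bigr => i _; rewrite /F /G /=.
case: (boolP (i \in O)) => iO; last first.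
  by case: ifP => _; rewrite mul1r ?add0r // addrC subrK.
by rewrite (disjointFr dOZ iO) addr0 mulr1.
Qed.

Lemma expect_cyl0 (O Z : {set I}) : ~~ [disjoint O & Z] -> expect (cyl O Z) = 0.
Proof.
rewrite -setI_eq0 => /set0Pn[i /setIP[iO iZ]].
apply: big1 => w _; rewrite /cyl.
case: (boolP (O \subset w)) => [/subsetP/(_ i iO) iw|]; last by rewrite mulr0.
case: (boolP [disjoint Z & w]) => [dZ|]; last by rewrite mulr0.
by have := disjointFr dZ iZ; rewrite iw.
Qed.

Lemma expect_const c : expect (fun=> c) = c.
Proof.
have E1 : expect (cyl set0 set0) = 1.
  by rewrite expect_cyl ?big_set0 ?mulr1 // disjoints_subset sub0set.
rewrite -[RHS]mulr1 -E1 -expectZ; apply: expect_ext => w.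
by rewrite /cyl sub0set disjoints_subset sub0set mulr1.
Qed.

Lemma expect_cyl_indep (O Z O' Z' : {set I}) :
  [disjoint O & Z] -> [disjoint O' & Z'] ->
  [disjoint O :|: Z & O' :|: Z'] ->
  expect (fun w => cyl O Z w * cyl O' Z' w) =
  expect (cyl O Z) * expect (cyl O' Z').
Proof.
move=> d1 d2; rewrite -setI_eq0 setIUl !setIUr !setU_eq0.
rewrite !setI_eq0 => /andP[/andP[dOO dOZ] /andP[dZO dZZ]].
have dU : [disjoint O :|: O' & Z :|: Z'].
  rewrite -setI_eq0 setIUl !setIUr !setU_eq0 !setI_eq0 d1 d2 dOZ.
  by rewrite disjoint_sym dZO.
rewrite (expect_ext (cylM O Z O' Z')) (expect_cyl dU) (expect_cyl d1) (expect_cyl d2).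
have prodU (A B : {set I}) (F : I -> R) : [disjoint A & B] ->
    \prod_(i in A :|: B) F i = (\prod_(i in A) F i) * \prod_(i in B) F i.
  by move=> dAB; rewrite -(bigU _ _ F dAB); apply: eq_bigl => i; rewrite !inE.
by rewrite !prodU // mulrACA.
Qed.

Hypothesis p01 : forall i, 0 <= p i <= 1.

Lemma prob_weight_ge0 w : 0 <= prob_weight w.
Proof.
apply: prodr_ge0 => i _; have /andP[p0 p1] := p01 i.
by case: ifP => // _; rewrite subr_ge0.
Qed.

Lemma expect_le f g : (forall w, f w <= g w) -> expect f <= expect g.
Proof. by move=> fg; apply: ler_sum => w _; rewrite ler_wpM2l ?prob_weight_ge0. Qed.

Lemma expect_ge0 f : (forall w, 0 <= f w) -> 0 <= expect f.
Proof. by move=> f0; apply: sumr_ge0 => w _; rewrite mulr_ge0 ?prob_weight_ge0. Qed.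

Lemma expect_attained f : exists w, expect f <= f w.
Proof.
have [w /= wmax] : exists w, forall w', f w' <= f w.
  by exists [arg max_(w > set0) f w]%O; case: arg_maxP => // w _ wm w'; apply: wm.
exists w; rewrite -[leRHS]expect_const; exact: expect_le.
Qed.

(* Chebyshev's inequality; pairwise uncorrelated indicators suffice, so the
   variance is at most the mean. *)
Lemma chebyshev_indicators (J : finType) (P : pred J) (x : J -> {set I} -> R)
    (m t : R) :
  (forall j w, x j w * x j w = x j w) ->
  (forall j j', P j -> P j' -> j != j' ->
     expect (fun w => x j w * x j' w) <= expect (x j) * expect (x j')) ->
  \sum_(j | P j) expect (x j) <= m -> m < t ->
  expect (fun w => ((t <= \sum_(j | P j) x j w)%R)%:R) <= m / (t - m) ^+ 2.
Proof.
move=> xx cov mE mt; set X := fun w => \sum_(j | P j) x j w.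
have x0 j w : 0 <= x j w by rewrite -xx -expr2 sqr_ge0.
set mu := \sum_(j | P j) expect (x j) in mE.
have EX : expect X = mu by rewrite expect_sum.
have mu0 : 0 <= mu by apply: sumr_ge0 => j _; apply: expect_ge0.
have EXX : expect (fun w => X w * X w) <= mu + mu ^+ 2.
  have -> : expect (fun w => X w * X w) =
      \sum_(j | P j) \sum_(j' | P j') expect (fun w => x j w * x j' w).
    rewrite -(eq_bigr _ (fun j _ => expect_sum P (fun j' w => x j w * x j' w))).
    rewrite -expect_sum; apply: expect_ext => w.
    by rewrite [LHS]mulr_suml; apply: eq_bigr => j _; rewrite mulr_sumr.
  rewrite expr2 {1}/mu {2}/mu mulr_suml -big_split; apply: ler_sum => j Pj.
  rewrite (bigD1 j) //= (expect_ext (fun w => xx j w)) lerD2l.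
  rewrite /mu mulr_sumr [leRHS](bigD1 j) //=.
  rewrite -[leLHS]add0r lerD ?mulr_ge0 ?expect_ge0 // ler_sum // => j' /andP[Pj' jj'].
  by apply: cov; rewrite // eq_sym.
have tm : 0 < t - m by rewrite subr_gt0.
have tmu : t - m <= t - mu by rewrite lerD2l lerN2.
rewrite ler_pdivlMr ?exprn_gt0 // mulrC -expectZ.
apply: (@le_trans _ _ (expect (fun w => (X w * X w) - 2 * mu * X w + mu ^+ 2))).
  apply: expect_le => w.
  have -> : X w * X w - 2 * mu * X w + mu ^+ 2 = (X w - mu) ^+ 2 by ring.
  case: (boolP (t <= _)) => [tX | _]; last by rewrite mulr0 sqr_ge0.
  rewrite mulr1 lerXn2r ?nnegrE ?(ltW tm) //.
    by rewrite subr_ge0 (le_trans _ tX) // (le_trans mE) // ltW.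
  by apply: (le_trans tmu); rewrite lerD2r.
rewrite expectD expectB expectZ EX expect_const.
by apply: le_trans mE; move: EXX; lra.
Qed.

End RandomSubset.

(** * Hypergraphs without short cycles *)

Section Hypergraphs.
Variable T : finType.
Implicit Types (H : {set {set T}}) (U S A B e f g : {set T}).

Definition indep H S := forall e, e \in H -> ~~ (e \subset S).

(* No Berge cycle of length 2, 3 or 4; once there is none of length 2, two
   edges of a longer cycle that coincide force consecutive ones to coincide. *)
Definition no_short_cycle H :=
  [/\ forall e f x y, e \in H -> f \in H -> x != y ->
        x \in e -> y \in e -> x \in f -> y \in f -> e = f,
      forall e f g x y z, e \in H -> f \in H -> g \in H ->
        x != y -> y != z -> z != x ->
        x \in e -> y \in e -> y \in f -> z \in f -> z \in g -> x \in g ->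
        e = f
    & forall e f g h x y z w, e \in H -> f \in H -> g \in H -> h \in H ->
        x != y -> y != z -> z != w -> w != x -> x != z -> y != w ->
        x \in e -> y \in e -> y \in f -> z \in f ->
        z \in g -> w \in g -> w \in h -> x \in h ->
        [\/ e = f, f = g, g = h | h = e]].

(** Indexed by the number [b] of other vertices of the edge, which is the power of [M] in the degree
    bounds. *)
Definition deg H (v : T) (b : nat) : nat :=
  #|[set e in H | (v \in e) && (#|e| == b.+1)]|.

(** The vertices whose selection alone discards [u]; an edge of larger size needs several selections
    to do so. *)
Definition nbhd2 H (u : T) : {set T} :=
  [set w | (w != u) && ([set u; w] \in H)].

Lemma card_nbhd2 H u : (#|nbhd2 H u| <= deg H u 1)%N.
Proof.
rewrite -(card_in_imset (f := fun w => [set u; w])).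
  apply: subset_leq_card; apply/subsetP => _ /imsetP[w + ->].
  by rewrite !inE cards2 eqxx eq_sym => /andP[-> ->].
move=> w w'; rewrite !inE => /andP[wu _] /andP[w'u _] /setP/(_ w).
by rewrite !inE (negPf wu) eqxx => /esym/eqP.
Qed.

(* The random choices that decide whether the neighbour u of v survives,
   given that v itself is not selected. *)
Definition block H v u : {set T} := u |: (nbhd2 H u :\ v).

Lemma block_self H v u : u \in block H v u.
Proof. by rewrite setU11. Qed.

Lemma card_block H v u : (#|nbhd2 H u| <= #|block H v u|)%N.
Proof.
rewrite cardsU1 (cardsD1 v (nbhd2 H u)) leq_add2r.
have -> : u \notin nbhd2 H u :\ v by rewrite !inE eqxx andbF.
exact: leq_b1.
Qed.

(** A vertex common to both blocks would close a Berge cycle of length 3 or 4 through the edges of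
    size 2 at [u] and [u']. The case [e = f] is included. *)
Lemma block_disjoint H v e f u u' : no_short_cycle H ->
  e \in H -> f \in H -> v \in e -> v \in f ->
  u \in e :\ v -> u' \in f :\ v -> u != u' ->
  [disjoint block H v u & block H v u'].
Proof.
move=> [C2 C3 C4] eH fH ve vf /setD1P[uv ue] /setD1P[u'v u'f] uu'.
have vu : v != u by rewrite eq_sym.
have vu' : v != u' by rewrite eq_sym.
have tri w w' g : w != v -> w' != v -> w != w' -> [set w; w'] \in H ->
    g \in H -> v \in g -> w \in g -> forall h, h \in H -> v \in h -> w' \in h -> False.
  move=> wv w'v ww' wH gH vg wg h hH vh w'h.
  have E : g = [set w; w'].
    by apply: (C3 g [set w; w'] h v w w') => //; rewrite ?inE ?eqxx ?orbT // eq_sym.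
  by move: vg; rewrite E !inE !(eq_sym v) (negPf wv) (negPf w'v).
rewrite -setI_eq0; apply/eqP/setP => w; rewrite [RHS]inE.
apply/negbTE/negP => /setIP[/setU1P[->|/setD1P[wv wN]] /setU1P[|/setD1P[w'v w'N]]].
- by move/eqP; apply/negP.
- move: w'N; rewrite inE => /andP[_ gH].
  by apply: (tri u' u f _ _ _ gH _ _ _ e) => //; rewrite eq_sym.
- move=> wE; move: wN; rewrite inE wE => /andP[_ gH].
  exact: (tri u u' e _ _ _ gH _ _ _ f).
(* Remaining case: [w] is joined to both [u] and [u'] by edges of size 2, and [v], [u], [w], [u']
   form a Berge cycle of length 4. If [e = f] it degenerates to the triangle [u], [w], [u']. *)
move: wN w'N; rewrite !inE => /andP[wu g1H] /andP[wu' g2H].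
have g12 : [set u; w] <> [set u'; w].
  move/setP/(_ u); rewrite !inE eqxx (negPf uu') /= => /esym/eqP uw.
  by move: wu; rewrite uw eqxx.
have ug1 : u \in [set u; w] by rewrite !inE eqxx.
have wg1 : w \in [set u; w] by rewrite !inE eqxx orbT.
have u'g2 : u' \in [set u'; w] by rewrite !inE eqxx.
have wg2 : w \in [set u'; w] by rewrite !inE eqxx orbT.
have vg1 : v \notin [set u; w] by rewrite !inE (negPf vu) eq_sym (negPf wv).
have vg2 : v \notin [set u'; w] by rewrite !inE (negPf vu') eq_sym (negPf wv).
have uw : u != w by rewrite eq_sym.
have vw : v != w by rewrite eq_sym.
have [] := C4 e [set u; w] [set u'; w] f v u w u' => //.
- by move=> E; move: vg1; rewrite -E ve.
- by move=> E; move: vg2; rewrite E vf.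
move=> E; move: u'f; rewrite E => u'e.
by apply: g12; apply: (C3 _ _ e u w u') => //; rewrite eq_sym.
Qed.

End Hypergraphs.

(** * Edges left after a set of vertices has been selected *)

Section Residual.
Variable T : finType.
Implicit Types (H : {set {set T}}) (a S J V e : {set T}).

(** What an independent set inside [V] must still avoid once [a] counts as taken. Edges reaching
    outside [a :|: V] can no longer be completed and are dropped. *)
Definition residual H a V : {set {set T}} :=
  [set e :\: a | e in [set e in H | (e :\: a != set0) && (e :\: a \subset V)]].

Lemma residualP H a V e' : reflect
  (exists e, [/\ e \in H, e' = e :\: a, e' != set0 & e' \subset V])
  (e' \in residual H a V).
Proof.
apply: (iffP imsetP) => [[e + ->]|[e [eH -> e0 eV]]].
  by rewrite inE => /and3P[eH e0 eV]; exists e.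
by exists e; rewrite // inE eH e0.
Qed.

Lemma residual_no_short_cycle H a V :
  no_short_cycle H -> no_short_cycle (residual H a V).
Proof.
move=> [C2 C3 C4]; split.
- move=> _ _ x y /residualP[e [eH -> _ _]] /residualP[f [fH -> _ _]] xy.
  move=> /setDP[xe _] /setDP[ye _] /setDP[xf _] /setDP[yf _].
  by rewrite (C2 e f x y).
- move=> _ _ _ x y z /residualP[e [eH -> _ _]] /residualP[f [fH -> _ _]]
    /residualP[g [gH -> _ _]] xy yz zx.
  move=> /setDP[xe _] /setDP[ye _] /setDP[yf _] /setDP[zf _] /setDP[zg _].
  by move=> /setDP[xg _]; rewrite (C3 e f g x y z).
move=> _ _ _ _ x y z w /residualP[e [eH -> _ _]] /residualP[f [fH -> _ _]]
  /residualP[g [gH -> _ _]] /residualP[h [hH -> _ _]] xy yz zw wx xz yw.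
move=> /setDP[xe _] /setDP[ye _] /setDP[yf _] /setDP[zf _] /setDP[zg _].
move=> /setDP[wg _] /setDP[wh _] /setDP[xh _].
by have [->|->|->|->] := C4 e f g h x y z w eH fH gH hH xy yz zw wx xz yw
  xe ye yf zf zg wg wh xh; [constructor 1|constructor 2|constructor 3|constructor 4].
Qed.

(** If an edge lies in [S :|: J], its part off [a] lies in [J]: when nonempty it is a residual edge,
    when empty the edge lies in [S], since [J] misses [a]. Removing all of [a] and not just [S] errs
    on the safe side. *)
Lemma residual_indep H a V S J : S \subset a -> [disjoint V & a] ->
  indep H S -> J \subset V -> indep (residual H a V) J -> indep H (S :|: J).
Proof.
move=> Sa Va HS JV HJ e eH; apply/negP => eSJ.
have eaJ : e :\: a \subset J.
  apply/subsetP => x /setDP[xe xa]; case/setUP: (subsetP eSJ x xe) => // xS.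
  by rewrite (subsetP Sa _ xS) in xa.
case: (eqVneq (e :\: a) set0) => [ea0|ea0]; last first.
  have eaH : e :\: a \in residual H a V.
    by apply/residualP; exists e; split=> //; apply: subset_trans JV.
  by move: (HJ _ eaH); rewrite eaJ.
have ea : e \subset a by rewrite -setD_eq0 ea0.
move: (HS _ eH); apply/negP; rewrite negbK; apply/subsetP => x xe.
case/setUP: (subsetP eSJ x xe) => // xJ.
by have := disjointFr Va (subsetP JV _ xJ); rewrite (subsetP ea _ xe).
Qed.

Lemma deg_residual H a V v b : (deg (residual H a V) v b <=
  #|[set e in H | [&& v \in e :\: a, #|e :\: a| == b.+1 & e :\: a \subset V]]|)%N.
Proof.
apply: leq_trans (leq_imset_card (fun e => e :\: a) _).
apply: subset_leq_card; apply/subsetP => e'.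
rewrite inE => /andP[/residualP[e [eH -> _ eV]] /andP[ve se]].
by apply/imsetP; exists e; rewrite // inE eH ve se.
Qed.

End Residual.

(** * One round of the nibble *)

Lemma prod_bool_pair (R : realFieldType) (T : finType) (A : {set bool * T})
    (F : bool * T -> R) :
  \prod_(x in A) F x =
  (\prod_(u | (true, u) \in A) F (true, u)) *
  \prod_(u | (false, u) \in A) F (false, u).
Proof.
transitivity (\prod_(b : bool) \prod_(u | (b, u) \in A) F (b, u)).
  by rewrite pair_big_dep /=; apply: eq_big => [[b u]|[b u] _].
by rewrite big_bool.
Qed.

Lemma card_bigcup_disjoint (I T : finType) (B : {set I}) (F : I -> {set T}) :
  {in B &, forall i j, i != j -> [disjoint F i & F j]} ->
  #|\bigcup_(i in B) F i| = (\sum_(i in B) #|F i|)%N.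
Proof.
move=> dF; pose G i := if i \in B then F i else set0.
have -> : \bigcup_(i in B) F i = \bigcup_i G i by rewrite big_mkcond.
rewrite -sum1_card partition_disjoint_bigcup => [|i j ij].
  rewrite [RHS]big_mkcond; apply: eq_bigr => i _; rewrite sum1_card /G.
  by case: ifP; rewrite ?cards0.
rewrite /G; case: (boolP (i \in B)) => iB; last by rewrite -setI_eq0 set0I.
by case: (boolP (j \in B)) => jB; [exact: dF | rewrite -setI_eq0 setI0].
Qed.

Section NibbleRound.
Variables (R : realFieldType) (T : finType) (H : {set {set T}}).
Variables (pi q : R).
Implicit Types (e A B W : {set T}) (u v : T) (w : {set bool * T}).

(* (true, u): u is selected; (false, u): the coin that equalises the survival
   probability of u to q comes up favourably. *)
Definition coin u : R := q / (1 - pi) ^+ #|nbhd2 H u|.+1.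
Definition round_prob (x : bool * T) : R := if x.1 then pi else coin x.2.

Definition selected w : {set T} := [set u | (true, u) \in w].

(** Constraints on a round: [ones A B] selects [A] and makes the coins of [B] favourable, [zeros W]
    leaves [W] unselected. *)
Definition ones A B : {set bool * T} :=
  [set x | if x.1 then x.2 \in A else x.2 \in B].
Definition zeros W : {set bool * T} := [set x | x.1 && (x.2 \in W)].

Lemma cyl_onesP (A B W : {set T}) w : ((ones A B \subset w) && [disjoint zeros W & w]) =
  [&& A \subset selected w, [forall u in B, (false, u) \in w] &
      [disjoint W & selected w]].
Proof.
rewrite andbA; congr (_ && _).
  apply/subsetP/andP => [Ow|[/subsetP AW /forall_inP BW] [[] u]].
  - split; first by apply/subsetP => u uA; rewrite inE Ow // inE.
    by apply/forall_inP => u uB; rewrite Ow // inE.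
  - by rewrite inE => /AW; rewrite inE.
  - by rewrite inE => /BW.
rewrite -!setI_eq0; apply/eqP/eqP => /setP E; apply/setP.
  by move=> u; have := E (true, u); rewrite !inE.
by case=> [[] u]; rewrite !inE //=; have := E u; rewrite !inE.
Qed.

Hypotheses (pi0 : 0 <= pi) (pi1 : pi < 1) (q0 : 0 <= q).
Hypothesis qle : forall u, q <= (1 - pi) ^+ #|nbhd2 H u|.+1.

Let pi1' : 0 < 1 - pi. Proof. by rewrite subr_gt0. Qed.

Lemma round_prob01 x : 0 <= round_prob x <= 1.
Proof.
case: x => [[] u]; rewrite /round_prob /=; first by rewrite pi0 ltW.
rewrite /coin divr_ge0 ?exprn_ge0 ?(ltW pi1') //=.
by rewrite ler_pdivrMr ?exprn_gt0 // mul1r.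
Qed.

Lemma expect_ones (A B W : {set T}) : [disjoint A & W] ->
  expect round_prob (cyl R (ones A B) (zeros W)) =
  pi ^+ #|A| * (\prod_(u in B) coin u) * (1 - pi) ^+ #|W|.
Proof.
move=> dAW; rewrite expect_cyl.
  rewrite !prod_bool_pair /round_prob /=.
  rewrite -!prodr_const; congr (_ * _ * _).
  - by apply: eq_bigl => u; rewrite inE.
  - by apply: eq_bigl => u; rewrite inE.
  rewrite [X in _ * X]big_pred0 => [|u]; last by rewrite inE.
  by rewrite mulr1; apply: eq_bigl => u; rewrite inE.
rewrite -setI_eq0; apply/eqP/setP => [[[] u]]; rewrite !inE //=.
  by case: (boolP (u \in A)) => // uA; rewrite (disjointFr dAW uA).
by rewrite andbF.
Qed.

Definition survives v : {set bool * T} -> R :=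
  cyl R (ones set0 [set v]) (zeros (v |: nbhd2 H v)).

Lemma expect_survives v : expect round_prob (survives v) = q.
Proof.
rewrite expect_ones ?disjoints_subset ?sub0set // cards0 expr0 mul1r big_set1.
rewrite cardsU1 inE eqxx /= add1n /coin divfK //.
by rewrite expf_neq0 // lt0r_neq0.
Qed.

(** The event that the edge [x.1] shrinks to [v |: x.2] with all of [x.2] surviving, given that [v]
    is not selected; it constrains neither the selection nor the coin of [v]. *)
Definition link_cyl v (x : {set T} * {set T}) : {set bool * T} -> R :=
  cyl R (ones ((x.1 :\ v) :\: x.2) x.2)
        (zeros (\bigcup_(u in x.2) block H v u)).

Definition link_idx v a : pred ({set T} * {set T}) :=
  fun x => [&& x.1 \in H, v \in x.1, x.2 \subset x.1 :\ v & #|x.2| == a].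

Hypothesis Hcycle : no_short_cycle H.

Lemma link_disjoint v a x : link_idx v a x ->
  [disjoint (x.1 :\ v) :\: x.2 & \bigcup_(u in x.2) block H v u].
Proof.
case: x => e B /and4P[/= eH ve Be _].
rewrite -setI_eq0; apply/eqP/setP => u; rewrite [RHS]inE.
apply/negbTE/negP => /setIP[/setDP[ue uB] /bigcupP[u' u'B uu']].
have u'e := subsetP Be _ u'B.
have d : u != u' by apply: contraNneq uB => ->.
have := block_disjoint Hcycle eH eH ve ve ue u'e d.
by move=> /disjointFr/(_ (block_self H v u)); rewrite uu'.
Qed.

(** The blocks are disjoint, so each surviving vertex contributes its own factor. A block may lack
    [v], while the exponent in [coin] counts it; this costs the factor [1 / (1 - pi)]. *)
Lemma expect_link_cyl v a x : link_idx v a x ->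
  expect round_prob (link_cyl v x) <=
  pi ^+ (#|x.1|.-1 - a) * (q / (1 - pi)) ^+ a.
Proof.
move=> xP; rewrite expect_ones ?(link_disjoint xP) //.
case: x xP => e B /and4P[/= eH ve Be /eqP Ba].
have -> : #|(e :\ v) :\: B| = (#|e|.-1 - a)%N.
  by rewrite cardsD (setIidPr Be) (cardsD1 v e) ve Ba.
rewrite -mulrA ler_wpM2l ?exprn_ge0 //.
rewrite card_bigcup_disjoint; last first.
  move=> u u' uB u'B; apply: (block_disjoint Hcycle eH eH ve ve).
    exact: (subsetP Be).
  exact: (subsetP Be).
rewrite -Ba -prodr_const -prodrXr -big_split /=; apply: ler_prod => u uB.
rewrite mulr_ge0 ?exprn_ge0 ?(ltW pi1') ?divr_ge0 ?exprn_ge0 ?(ltW pi1') //=.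
rewrite /coin exprS invfM mulrA -[leRHS]mulr1 -!mulrA ler_wpM2l //.
rewrite ler_wpM2l ?invr_ge0 ?(ltW pi1') // mulrC ler_pdivrMr ?exprn_gt0 // mul1r.
by rewrite ler_wiXn2l ?(ltW pi1') ?card_block // gerBl.
Qed.

(** Two shrinkings of the same edge exclude each other, as some vertex is selected in one and
    unselected in the other. Distinct edges at [v] meet only there, so their blocks are disjoint and
    the events independent. *)
Lemma link_cyl_uncorrelated v a x x' : link_idx v a x -> link_idx v a x' ->
  x != x' -> expect round_prob (fun w => link_cyl v x w * link_cyl v x' w) <=
  expect round_prob (link_cyl v x) * expect round_prob (link_cyl v x').
Proof.
move=> xP xP'; have d := link_disjoint xP; have d' := link_disjoint xP'.
case: x x' xP xP' d d' => e B [f C] /and4P[/= eH ve Be /eqP Ba].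
move=> /and4P[/= fH vf Cf /eqP Ca] d d' neq.
have dz A D W : [disjoint A & W] -> [disjoint ones A D & zeros W].
  move=> dAW; rewrite -setI_eq0; apply/eqP/setP => [[[] u]]; rewrite !inE //=.
    by case: (boolP (u \in A)) => // uA; rewrite (disjointFr dAW uA).
  by rewrite andbF.
have [efE|ef] := eqVneq e f.
  rewrite -efE in fH vf Cf d' neq *.
  have BC : B != C by apply: contraNneq neq => ->.
  rewrite (expect_ext _ (cylM _ _ _ _ _)) expect_cyl0 ?mulr_ge0 //.
    by apply: expect_ge0 => [|w]; [exact: round_prob01 | exact: cyl_ge0].
    by apply: expect_ge0 => [|w]; [exact: round_prob01 | exact: cyl_ge0].
  have [u uB uC] : exists2 u, u \in B & u \notin C.
    by apply/subsetPn; apply: contraNN BC => BC; rewrite eqEcard BC Ba Ca /=.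
  rewrite -setI_eq0; apply/set0Pn; exists (true, u); rewrite !inE /=.
  have /setD1P[uv ue] := subsetP Be _ uB.
  rewrite uv ue uC orbT /=; apply/orP; left.
  by apply/bigcupP; exists u => //; exact: block_self.
rewrite le_eqVlt; apply/orP; left; apply/eqP.
apply: expect_cyl_indep; try exact: dz.
have key u u' : u \in e :\ v -> u' \in f :\ v -> [disjoint block H v u & block H v u'].
  move=> ue u'f; apply: (block_disjoint Hcycle eH fH) => //.
  apply: contraNneq ef => uu'; case: Hcycle => C2 _ _; apply/eqP.
  move: ue u'f; rewrite -uu' => /setD1P[uv ue] /setD1P[_ uf].
  exact: (C2 e f u v).
have supp g (D : {set T}) (z : bool * T) : D \subset g :\ v ->
    z \in ones ((g :\ v) :\: D) D :|: zeros (\bigcup_(u in D) block H v u) ->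
    exists2 u, u \in g :\ v & z.2 \in block H v u.
  move=> Dg; case: z => [[] u]; rewrite inE => /orP[]; rewrite inE /=.
  - by move=> /setDP[ug _]; exists u => //; exact: block_self.
  - by move=> /bigcupP[u' u'D uu']; exists u' => //; exact: (subsetP Dg).
  - by move=> uD; exists u; [exact: (subsetP Dg) | exact: block_self].
  - by [].
rewrite -setI_eq0; apply/eqP/setP => z; rewrite [RHS]inE.
apply/negbTE/negP => /setIP[/(supp _ _ _ Be)[u ue zu] /(supp _ _ _ Cf)[u' u'f zu']].
by have := disjointFr (key _ _ ue u'f) zu; rewrite zu'.
Qed.

End NibbleRound.

(** * Degree bounds as coefficients of a polynomial *)

Lemma bin_mul_bin n b a : (a <= b)%N -> (b <= n)%N ->
  ('C(n, b) * 'C(b, a) = 'C(n, a) * 'C(n - a, b - a))%N.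
Proof.
move=> ab bn; have an := leq_trans ab bn.
have bna : (b - a <= n - a)%N by rewrite leq_sub2r.
apply/eqP; rewrite -(eqn_pmul2r (fact_gt0 (b - a))) -(eqn_pmul2r (fact_gt0 a)).
rewrite -(eqn_pmul2r (fact_gt0 (n - b))).
have E1 := bin_fact ab; have E2 := bin_fact bn.
have E3 := bin_fact an; have E4 := bin_fact bna.
have E5 : (n - a - (b - a) = n - b)%N by lia.
rewrite E5 in E4; apply/eqP.
transitivity n`!; first by rewrite -E2 -E1; ring.
by rewrite -E3 -E4; ring.
Qed.

(** Both sides are the coefficient of [z ^ a] in [(y + M (p + q z)) ^ r]. *)
Lemma sum_binomial_thinning (R : comPzRingType) (r a : nat) (M y p q : R) :
  (a <= r)%N ->
  \sum_(b < r.+1) ('C(r, b)%:R * M ^+ b * y ^+ (r - b)) *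
                  ('C(b, a)%:R * (p ^+ (b - a) * q ^+ a)) =
  'C(r, a)%:R * (q * M) ^+ a * (y + p * M) ^+ (r - a).
Proof.
move=> ar; rewrite -(big_mkord xpredT (fun b => ('C(r, b)%:R * M ^+ b * y ^+ (r - b)) *
                  ('C(b, a)%:R * (p ^+ (b - a) * q ^+ a)))).
rewrite (@big_cat_nat _ _ _ a) ?leqW //= big_nat big1 ?add0r; last first.
  by move=> b /andP[_ ba]; rewrite [X in _ * (X%:R * _)]bin_small // mul0r mulr0.
rewrite -{1}[a]add0n big_addn subSn // big_mkord exprDn mulr_sumr.
apply: eq_bigr => c _; have cr : (c <= r - a)%N by rewrite -ltnS.
have E : ('C(r, c + a) * 'C(c + a, a) = 'C(r, a) * 'C(r - a, c))%N.
  by rewrite bin_mul_bin ?leq_addl ?addnK // addnC -leq_subRL.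
have -> : (r - (c + a) = r - a - c)%N by lia.
rewrite addnK -mulr_natr.
transitivity (('C(r, c + a) * 'C(c + a, a))%:R * (M ^+ (c + a) * y ^+ (r - a - c) * p ^+ c * q ^+ a)).
  by rewrite natrM; ring.
by rewrite E natrM exprD !exprMn; ring.
Qed.

Section Sparse.
Variables (R : realFieldType) (T : finType).
Implicit Types (H : {set {set T}}) (v : T) (r : nat) (M y : R).

(* The degree bounds are the coefficients of (y + M z) ^ r, so that substituting
   z := p + q z, the effect of one round, yields bounds of the same shape. *)
Definition sparse H r M y :=
  (forall e, e \in H -> (1 < #|e|)%N) /\
  (forall v b, (deg H v b)%:R <= 'C(r, b)%:R * M ^+ b * y ^+ (r - b)).

(** The binomial coefficient vanishes beyond [r], so the degree bounds also cap the edge sizes. *)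
Lemma sparse_card H r M y e : sparse H r M y -> e \in H -> (#|e| <= r.+1)%N.
Proof.
move=> [H1 Hd] eH; have e1 := H1 _ eH.
have /card_gt0P[v ve] : (0 < #|e|)%N by apply: leq_trans e1.
rewrite leqNgt; apply/negP => re; have := Hd v #|e|.-1.
have -> : 'C(r, #|e|.-1) = 0%N by apply: bin_small; lia.
rewrite mul0r mul0r lern0 cards_eq0 => /eqP/setP/(_ e).
by rewrite !inE eH ve prednK ?eqxx //; lia.
Qed.

Lemma sum_link_sizes H r M y v (F : nat -> R) : sparse H r M y ->
  (forall b, 0 <= F b) ->
  \sum_(e in H | v \in e) F #|e|.-1 <=
  \sum_(b < r.+1) 'C(r, b)%:R * M ^+ b * y ^+ (r - b) * F b.
Proof.
move=> sH F0.
rewrite (partition_big (fun e : {set T} => inord #|e|.-1 : 'I_r.+1) xpredT) //=.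
apply: ler_sum => b _; apply: le_trans (_ : (deg H v b)%:R * F b <= _); last first.
  by rewrite ler_wpM2r //; exact: sH.2.
rewrite /deg -sum1_card natr_sum mulr_suml le_eqVlt; apply/orP; left; apply/eqP.
have bE e : e \in H -> v \in e -> (inord #|e|.-1 == b :> 'I_r.+1) = (#|e| == b.+1).
  move=> eH ve; have er := sparse_card sH eH; have e1 := sH.1 _ eH.
  by rewrite -val_eqE /= inordK; lia.
apply: eq_big => [e|e /andP[/andP[eH ve]]].
  rewrite inE -andbA; case: (boolP (e \in H)) => //= eH.
  by case: (boolP (v \in e)) => //= ve; rewrite bE.
by rewrite bE // => /eqP ->; rewrite mul1r.
Qed.

(** As [p * M <= 1], every power from the [s]-th on is at most the [s]-th, and the binomial
    coefficients add up to [2 ^ r]. With [s = 1] this counts fully selected edges at a selected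
    vertex, with [s = 2] edges of size at least 3 that are selected up to [v]. *)
Lemma sum_binomial_tail (r s : nat) (M y p : R) : 0 < M -> 1 <= y -> 0 <= p ->
  p * M <= 1 ->
  \sum_(b < r.+1) 'C(r, b)%:R * M ^+ b * y ^+ (r - b) *
    (if (s <= b)%N then p ^+ b else 0) <= 2 ^+ r * (p * M) ^+ s * y ^+ r.
Proof.
move=> M0 y1 p0 pM1; have y0 : 0 <= y by apply: le_trans y1.
have pM0 : 0 <= p * M by rewrite mulr_ge0 // ltW.
have -> : 2 ^+ r = \sum_(b < r.+1) 'C(r, b)%:R :> R.
  have -> : 2 = 1 + 1 :> R by [].
  by rewrite exprDn; apply: eq_bigr => b _; rewrite !expr1n mul1r.
rewrite -mulrA mulr_suml; apply: ler_sum => b _.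
case: ifP => [sb|_]; last by rewrite mulr0 !mulr_ge0 ?exprn_ge0.
rewrite -!mulrA ler_wpM2l // [leLHS](_ : _ = (p * M) ^+ b * y ^+ (r - b)).
  apply: ler_pM; rewrite ?exprn_ge0 //; first exact: ler_wiXn2l.
  by rewrite ler_weXn2l ?leq_subr.
by rewrite exprMn; ring.
Qed.

End Sparse.

Lemma bernoulli_le (R : realFieldType) (x : R) n :
  0 <= x -> x <= 1 -> 1 - x * n%:R <= (1 - x) ^+ n.
Proof.
move=> x0 x1; elim: n => [|n IH]; first by rewrite mulr0 subr0 expr0.
rewrite exprS; apply: le_trans (_ : (1 - x) * (1 - x * n%:R) <= _).
  have : 0 <= x * x * n%:R by rewrite !mulr_ge0.
  by rewrite -natr1; lra.
by rewrite ler_wpM2l // subr_ge0.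
Qed.

(** * Expected gain and loss of one round *)

Section Round.
Variables (R : realFieldType) (T : finType) (H : {set {set T}}) (U : {set T}).
Variables (r : nat) (M y theta q delta : R).

(** The selection rate is scaled by [M] so that a round raises [y] by [pi * M = theta]; [delta] is
    the relative slack allowed for the fluctuation of degrees. *)
Let pi := theta / M.

Hypotheses (Hcycle : no_short_cycle H) (Hsparse : sparse H r M y).
Hypotheses (M0 : 0 < M) (y1 : 1 <= y) (theta0 : 0 < theta) (theta1 : theta <= 1).
Hypotheses (pi1 : pi < 1) (q0 : 0 < q) (delta0 : 0 < delta).
Hypothesis q_le : q <= 1 - pi * (1 + r%:R * M * y ^+ r.-1).
Hypothesis qM1 : 1 <= q * M.
Hypothesis delta_pi : 1 + delta / 2 <= (1 + delta) * (1 - pi).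

Let pi_gt0 : 0 < pi. Proof. by rewrite divr_gt0. Qed.
Let pi_ge0 : 0 <= pi. Proof. exact: ltW. Qed.
Let pi1' : 0 < 1 - pi. Proof. by rewrite subr_gt0. Qed.
Let y0 : 0 <= y. Proof. exact: le_trans y1. Qed.
Let piM : pi * M = theta. Proof. by rewrite divfK // gt_eqF. Qed.

Lemma survival_le u : q <= (1 - pi) ^+ #|nbhd2 H u|.+1.
Proof.
apply: le_trans (bernoulli_le _ pi_ge0 (ltW pi1)); apply: (le_trans q_le).
rewrite lerD2l lerN2 ler_wpM2l // -nat1r lerD2l.
have := Hsparse.2 u 1%N; rewrite bin1 expr1 subn1; apply: le_trans.
by rewrite ler_nat card_nbhd2.
Qed.

Let p01 := round_prob01 pi_ge0 pi1 (ltW q0) survival_le.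

Notation E := (expect (round_prob H pi q)).

Definition link_sum v b w : R := \sum_(x | link_idx H v b x) link_cyl R H v x w.

Let mean b := 'C(r, b)%:R * (q / (1 - pi) * M) ^+ b * (y + theta) ^+ (r - b).

Lemma expect_link_sum v b : (b <= r)%N ->
  \sum_(x | link_idx H v b x) E (link_cyl R H v x) <= mean b.
Proof.
move=> br; rewrite /mean -piM -sum_binomial_thinning //.
apply: le_trans (sum_link_sizes v Hsparse (F := fun c => 'C(c, b)%:R * (pi ^+ (c - b) *
                   (q / (1 - pi)) ^+ b)) _); last first.
  by move=> c; rewrite !mulr_ge0 ?exprn_ge0 ?divr_ge0 // ltW.
apply: (@le_trans _ _ (\sum_(x | link_idx H v b x)
   pi ^+ (#|x.1|.-1 - b) * (q / (1 - pi)) ^+ b)).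
  by apply: ler_sum => x xP; exact: (expect_link_cyl pi_ge0 pi1 (ltW q0) Hcycle xP).
rewrite le_eqVlt; apply/orP; left; apply/eqP.
transitivity (\sum_(e in H | v \in e) \sum_(B : {set T} | (B \subset e :\ v) && (#|B| == b))
   pi ^+ (#|e|.-1 - b) * (q / (1 - pi)) ^+ b).
  rewrite pair_big_dep /=; apply: eq_bigl => x.
  by rewrite /link_idx -!andbA.
apply: eq_bigr => e /andP[eH ve].
rewrite [LHS]sumr_const -[LHS]mulr_natl; congr (_%:R * _).
have -> : #|e|.-1 = #|e :\ v| by rewrite (cardsD1 v e) ve.
by rewrite -cards_draws; apply: eq_card => B; rewrite !inE.
Qed.

Let target b := 'C(r, b)%:R * (q * (1 + delta) * M) ^+ b * (y + theta) ^+ (r - b).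

(** Chebyshev with variance at most [mean b] and a gap of at least [delta / 2 * mean b] leaves
    [4 / (delta ^ 2 * mean b)], and [mean b] is at least [q * M] because [b] is positive. *)
Lemma expect_link_sum_large v b : (0 < b)%N -> (b <= r)%N ->
  E (fun w => ((target b <= link_sum v b w)%R)%:R) <= 4 / (delta ^+ 2 * q * M).
Proof.
move=> b0 br.
have yt1 : 1 <= y + theta by rewrite (le_trans y1) // lerDl ltW.
have q1M : q * M <= q / (1 - pi) * M.
  rewrite ler_wpM2r ?(ltW M0) // ler_pdivlMr // -[leRHS]mulr1 ler_wpM2l ?(ltW q0) //.
  by rewrite gerBl.
have q1M1 : 1 <= q / (1 - pi) * M by apply: le_trans q1M.
have mean_ge : q * M <= mean b.
  apply: (le_trans q1M); rewrite /mean -[leLHS]mul1r -[leLHS]mulr1.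
  apply: ler_pM; rewrite ?mul1r ?(le_trans ler01) ?exprn_ege1 //.
  rewrite -[leLHS]mul1r; apply: ler_pM; rewrite ?ler01 ?(le_trans ler01) //.
    by rewrite ler1n bin_gt0.
  by rewrite -[leLHS]expr1 ler_weXn2l.
have mean0 : 0 < mean b by apply: lt_le_trans mean_ge; apply: lt_le_trans qM1.
(* The slack [1 + delta] of the target absorbs the [1 / (1 - pi)] of the mean; by [delta_pi] a
   factor [1 + delta / 2] remains. *)
have target_ge : (1 + delta / 2) * mean b <= target b.
  have -> : target b = ((1 + delta) * (1 - pi)) ^+ b * mean b.
    have E1 : q * (1 + delta) * M = (1 + delta) * (1 - pi) * (q / (1 - pi) * M).
      by field; rewrite gt_eqF.
    by rewrite /target E1 exprMn /mean !mulrA (mulrC 'C(r, b)%:R).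
  rewrite ler_wpM2r ?(ltW mean0) // (le_trans delta_pi) //.
  have d1 : 1 <= (1 + delta) * (1 - pi).
    by apply: le_trans delta_pi; rewrite lerDl divr_ge0 // ltW.
  by rewrite -[leLHS]expr1 ler_weXn2l.
have gap : delta / 2 * mean b <= target b - mean b.
  by rewrite lerBrDr (le_trans _ target_ge) // mulrDl mul1r addrC.
have gap0 : 0 < delta / 2 * mean b by rewrite mulr_gt0 ?divr_gt0.
have := chebyshev_indicators (t := target b) p01 _ _ (expect_link_sum v br).
move=> /(_ _ _ _)/le_trans; apply.
- by move=> x w; rewrite /link_cyl cylM !setUid.
- move=> x x'.
  exact: (link_cyl_uncorrelated pi_ge0 pi1 (ltW q0) survival_le Hcycle).
- by rewrite -subr_gt0; exact: lt_le_trans gap.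
rewrite ler_pdivrMr ?exprn_gt0 ?(lt_le_trans gap0) //.
apply: (@le_trans _ _ (4 / (delta ^+ 2 * q * M) * (delta / 2 * mean b) ^+ 2)).
  have -> : 4 / (delta ^+ 2 * q * M) * (delta / 2 * mean b) ^+ 2 = mean b / (q * M) * mean b.
    by field; rewrite !gt_eqF.
  rewrite -[leLHS]mul1r ler_wpM2r ?(ltW mean0) // ler_pdivlMr ?mul1r //.
  by rewrite (lt_le_trans _ qM1).
rewrite ler_wpM2l ?divr_ge0 ?mulr_ge0 ?exprn_ge0 ?(ltW q0) ?(ltW M0) ?(ltW delta0) //.
by rewrite lerXn2r // ?nnegrE ?(ltW gap0) // (le_trans (ltW gap0)).
Qed.


Definition selection w : {set T} :=
  [set v in U | (v \in selected w) &&
     ~~ [exists e in H, (v \in e) && (e \subset selected w)]].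

(** Edges of size 2 are already dealt with in [survives], which has probability exactly [q].
    Completion by a larger edge and an excessive degree are rare, and such vertices are thrown
    away. *)
Definition leftover w : {set T} :=
  [set v in U | [&& survives R H v w == 1,
     ~~ [exists e in H, [&& v \in e, (2 < #|e|)%N & e :\ v \subset selected w]] &
     ~~ [exists b : 'I_r.+1, (0 < b)%N && (target b <= link_sum v b w)]]].

Lemma survivesP v w : survives R H v w == 1 ->
  [/\ (false, v) \in w, v \notin selected w & [disjoint nbhd2 H v & selected w]].
Proof.
rewrite /survives /cyl cyl_onesP.
case: (boolP [&& _, _ & _]) => [/and3P[_ /forall_inP c d] _|_]; last first.
  by rewrite eq_sym oner_eq0.
split; first by apply: c; rewrite inE.
  by rewrite (disjointFr d) // setU11.
by apply: disjointWl d; exact: subsetUr.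
Qed.

Lemma leftoverP v w : v \in leftover w ->
  [/\ v \in U, survives R H v w == 1,
     forall e, e \in H -> v \in e -> (2 < #|e|)%N -> ~~ (e :\ v \subset selected w) &
     forall b, (0 < b)%N -> (b <= r)%N -> link_sum v b w < target b].
Proof.
rewrite inE => /and4P[vU vS n1 n2]; split=> //.
  move=> e eH ve e2; apply: contraNN n1 => ev; apply/existsP; exists e.
  by rewrite eH ve e2.
move=> b b0 br; rewrite ltNge; apply: contraNN n2 => tb; apply/existsP.
by exists (Ordinal (br : (b < r.+1)%N)); rewrite b0.
Qed.

Lemma leftover_disjoint w : [disjoint leftover w & selected w].
Proof.
rewrite -setI_eq0; apply/eqP/setP => v; rewrite [RHS]inE.
apply/negbTE/negP => /setIP[/leftoverP[_ /survivesP[_ vs _] _ _]].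
by rewrite (negPf vs).
Qed.

Lemma selection_indep w : indep H (selection w).
Proof.
move=> e eH; apply/negP => eS; have e1 := Hsparse.1 _ eH.
have /card_gt0P[v ve] : (0 < #|e|)%N by apply: leq_trans e1.
have := subsetP eS _ ve; rewrite inE => /and3P[_ _ /existsP]; apply.
exists e; rewrite eH ve /=; apply: subset_trans eS _.
by apply/subsetP => u; rewrite /selection inE => /and3P[_].
Qed.

Lemma link_sum_card v b w : link_sum v b w =
  #|[set x | link_idx H v b x &&
      ((ones ((x.1 :\ v) :\: x.2) x.2 \subset w) &&
       [disjoint zeros (\bigcup_(u in x.2) block H v u) & w])]|%:R.
Proof.
rewrite -sum1_card natr_sum /link_sum [LHS]big_mkcond [RHS]big_mkcond.
apply: eq_bigr => x _; rewrite inE /link_cyl /cyl.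
by case: (link_idx _ _ _ _) => //=; case: (_ && _).
Qed.

(** In an edge that leaves a residue at [v], every other vertex is selected or survives, so the edge
    is counted by [link_sum v], which is below target for leftover [v]. A residue of size 1 would be
    a vertex completed by the selection, and those were discarded. *)
Lemma leftover_sparse w :
  sparse (residual H (selected w) (leftover w)) r (q * (1 + delta) * M) (y + theta).
Proof.
set a := selected w; set V := leftover w; have Va := leftover_disjoint w.
have size_gt1 e' : e' \in residual H a V -> (1 < #|e'|)%N.
  move=> /residualP[e [eH -> ne eV]]; have e1 := Hsparse.1 _ eH.
  rewrite ltnNge; apply/negP => e'1.
  have /cards1P[u eu] : #|e :\: a| == 1%N by rewrite eqn_leq e'1 card_gt0.
  have uV : u \in V by rewrite (subsetP eV) // eu inE.
  have /setDP[ue ua] : u \in e :\: a by rewrite eu inE.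
  have eua : e :\ u \subset a.
    apply/subsetP => x /setD1P[xu xe]; apply: contraNT xu => xa.
    have : x \in e :\: a by rewrite inE xa.
    by rewrite eu inE.
  have [_ /survivesP[_ _ ud] big _] := leftoverP uV.
  have [e2|e2] := ltnP 2 #|e|; first by move: (big e eH ue e2); rewrite eua.
  have /cards2P[x [z [xz exz]]] : #|e| == 2%N by rewrite eqn_leq e2 e1.
  have [w' wu Ew] : exists2 w', w' != u & e = [set u; w'].
    move: ue; rewrite exz => /set2P[->|->]; first by exists z; rewrite // eq_sym.
    by exists x; rewrite // setUC.
  have w'N : w' \in nbhd2 H u by rewrite inE wu -Ew eH.
  have := disjointFr ud w'N; rewrite (subsetP eua) // Ew.
  by rewrite !inE wu eqxx orbT.
split=> // v b.
have rhs0 : 0 <= 'C(r, b)%:R * (q * (1 + delta) * M) ^+ b * (y + theta) ^+ (r - b).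
  have d0 : 0 <= 1 + delta by rewrite addr_ge0 // ltW.
  have yt0 : 0 <= y + theta by rewrite addr_ge0 // ltW.
  by rewrite mulr_ge0 ?mulr_ge0 ?exprn_ge0 // !mulr_ge0 // ltW.
have deg0 : deg (residual H a V) v b = 0%N ->
    (deg (residual H a V) v b)%:R <= 'C(r, b)%:R * (q * (1 + delta) * M) ^+ b * (y + theta) ^+ (r - b).
  by move=> ->.
have [b0|b0] := posnP b.
  apply: deg0; apply/eqP; rewrite cards_eq0; apply/eqP/setP => e'; rewrite !inE.
  apply/negbTE/negP => /and3P[/size_gt1 e1 _]; rewrite b0 => /eqP e'1.
  by rewrite e'1 in e1.
have [br|rb] := leqP b r; last first.
  apply: deg0; apply/eqP; rewrite cards_eq0; apply/eqP/setP => e'; rewrite !inE.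
  apply/negbTE/negP => /and3P[/residualP[e [eH -> _ _]] _ /eqP eb].
  have := sparse_card Hsparse eH; have := subset_leq_card (subsetDl e a).
  by rewrite eb => be er; have := leq_trans be er; rewrite ltnS leqNgt rb.
have [vV|vV] := boolP (v \in V); last first.
  apply: deg0; apply/eqP; rewrite cards_eq0; apply/eqP/setP => e'; rewrite !inE.
  apply/negbTE/negP => /and3P[/residualP[e [eH -> _ eV]] ve _].
  by rewrite (subsetP eV _ ve) in vV.
have [_ vS _ small] := leftoverP vV.
apply: le_trans (ltW (small b b0 br)); rewrite link_sum_card ler_nat.
apply: leq_trans (deg_residual _ _ _ _ _) _.
have [_ va vd] := survivesP vS.
(* Each residual edge at [v] is matched with the event that records its original edge and its
   surviving vertices other than [v]. *)
rewrite -(card_in_imset (f := fun e => (e, (e :\: a) :\ v))); last by move=> e f _ _ [].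
apply: subset_leq_card; apply/subsetP => _ /imsetP[e eE ->].
rewrite inE in eE; have /and4P[eH veE eb eV] := eE; have /setDP[ve _] := veE.
rewrite inE cyl_onesP /link_idx /= eH ve setSD ?subsetDl //=.
have -> : #|(e :\: a) :\ v| == b.
  by have {}veE : v \in e :\: a by []; move: eb; rewrite (cardsD1 v) veE.
have BV u : u \in (e :\: a) :\ v -> u \in V.
  by move=> /setD1P[_ ue]; exact: (subsetP eV).
rewrite /=; apply/and3P; split.
- apply/subsetP => u; rewrite !inE; case: (u == v) => //=.
  by case: (u \in e); rewrite ?andbT ?andbF //= negbK.
- apply/forall_inP => u /BV uV.
  by have [_ /survivesP[] ] := leftoverP uV.
rewrite disjoint_sym disjoints_subset; apply/subsetP => x xa; rewrite inE.
apply/negP => /bigcupP[u /BV uV]; have [_ /survivesP[_ ua ud] _ _] := leftoverP uV.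
move=> /setU1P[xu|/setD1P[_ xN]]; first by rewrite -xu xa in ua.
by have := disjointFr ud xN; rewrite xa.
Qed.


Lemma expect_selected (A : {set T}) :
  E (cyl R (ones A set0) (zeros set0)) = pi ^+ #|A|.
Proof.
rewrite expect_ones ?cards0 ?expr0 ?mulr1 ?big_set0 ?mulr1 //.
by rewrite disjoint_sym disjoints_subset sub0set.
Qed.

Lemma cyl_selected (A : {set T}) w :
  cyl R (ones A set0) (zeros set0) w = (A \subset selected w)%:R.
Proof.
rewrite /cyl cyl_onesP disjoints_subset sub0set andbT.
suff -> : [forall u in set0, (false, u) \in w] by rewrite andbT.
by apply/forall_inP => u; rewrite inE.
Qed.

Lemma ler_nat_andN (b1 b2 : bool) (x : R) : b2%:R <= x ->
  b1%:R - x <= (b1 && ~~ b2)%:R.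
Proof. by case: b1; case: b2 => /= h; rewrite ?subr0; lra. Qed.

Lemma exists_le_sum (I : finType) (P Q : pred I) :
  [exists i, P i && Q i]%:R <= \sum_(i | P i) (Q i)%:R :> R.
Proof.
case: existsP => [[i /andP[Pi Qi]]|_]; last by apply: sumr_ge0 => i _; exact: ler0n.
by rewrite (bigD1 i) //= Qi lerDl; apply: sumr_ge0 => j _; exact: ler0n.
Qed.

Lemma expect_selection_ge :
  pi * (1 - 2 ^+ r * theta * y ^+ r) * #|U|%:R <=
  E (fun w => #|selection w|%:R).
Proof.
apply: (@le_trans _ _ (E (fun w => \sum_(v in U)
   (cyl R (ones [set v] set0) (zeros set0) w -
    \sum_(e in H | v \in e) cyl R (ones e set0) (zeros set0) w)))); last first.
  apply: expect_le => // w; rewrite -sum1_card natr_sum big_mkcond [leRHS]big_mkcond.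
  apply: ler_sum => v _; rewrite inE; case: (v \in U) => //=.
  rewrite cyl_selected sub1set; set b := [exists e in H, _].
  have /(ler_nat_andN (v \in selected w)) : b%:R <= \sum_(e in H | v \in e) (e \subset selected w)%:R :> R.
    apply: le_trans (exists_le_sum (fun e => (e \in H) && (v \in e)) (fun e => e \subset selected w)).
    by rewrite le_eqVlt; apply/orP; left; apply/eqP; congr (nat_of_bool _)%:R;
       apply: eq_existsb => e; rewrite andbA.
  under eq_bigr do rewrite cyl_selected.
  by case: (_ && _).
rewrite expect_sum mulr_natr -sumr_const; apply: ler_sum => v _.
rewrite expectB expect_selected cards1 expr1 expect_sum mulrBr mulr1 lerD2l lerN2.
have E1 : \sum_(e in H | v \in e) E (cyl R (ones e set0) (zeros set0)) =
    \sum_(e in H | v \in e) pi * (fun b => if (1 <= b)%N then pi ^+ b else 0) #|e|.-1.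
  apply: eq_bigr => e /andP[eH ve]; rewrite expect_selected /=.
  by have := Hsparse.1 _ eH; case: (#|e|) => [|[|m]] //= _; rewrite exprS.
rewrite E1 -mulr_sumr ler_wpM2l //.
have F0 b : 0 <= (if (1 <= b)%N then pi ^+ b else 0) by case: ifP; rewrite ?exprn_ge0.
apply: le_trans (sum_link_sizes v Hsparse F0) _.
by rewrite -piM -[pi * M]expr1; apply: sum_binomial_tail; rewrite ?piM.
Qed.

(** Union bound: the term in [theta ^ 2] pays for edges of size at least 3, which need two or more
    selected vertices besides [v]; the last term is one Chebyshev failure for each [b] from 1 to
    [r]. *)
Lemma expect_leftover_ge :
  (q - 2 ^+ r * theta ^+ 2 * y ^+ r - r%:R * (4 / (delta ^+ 2 * q * M))) * #|U|%:R <=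
  E (fun w => #|leftover w|%:R).
Proof.
apply: (@le_trans _ _ (E (fun w => \sum_(v in U)
   (survives R H v w -
    \sum_(e in H | (v \in e) && (2 < #|e|)%N) cyl R (ones (e :\ v) set0) (zeros set0) w
    - \sum_(b < r.+1 | (0 < b)%N) ((target b <= link_sum v b w)%R)%:R)))); last first.
  apply: expect_le => // w; rewrite -sum1_card natr_sum big_mkcond [leRHS]big_mkcond.
  apply: ler_sum => v _; rewrite inE; case: (v \in U) => //=.
  set b1 := [exists e in H, _]; set b2 := [exists b, _].
  have h1 : b1%:R <= \sum_(e in H | (v \in e) && (2 < #|e|)%N) cyl R (ones (e :\ v) set0) (zeros set0) w.
    under eq_bigr do rewrite cyl_selected.
    apply: le_trans (exists_le_sum (fun e => (e \in H) && ((v \in e) && (2 < #|e|)%N)) (fun e => e :\ v \subset selected w)).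
    by rewrite le_eqVlt; apply/orP; left; apply/eqP; congr (nat_of_bool _)%:R;
       apply: eq_existsb => e; rewrite !andbA.
  have h2 : b2%:R <= \sum_(b < r.+1 | (0 < b)%N) ((target b <= link_sum v b w)%R)%:R :> R.
    exact: exists_le_sum (fun b : 'I_r.+1 => (0 < b)%N) (fun b => target b <= link_sum v b w).
  have hS : survives R H v w = (survives R H v w == 1)%:R.
    by rewrite /survives /cyl; case: (_ && _); rewrite ?eqxx // eq_sym oner_eq0.
  have := lerD (ler_nat_andN (survives R H v w == 1) h1) (lexx 0).
  rewrite !addr0 -hS => h3; apply: le_trans (lerB h3 (lexx _)) _.
  apply: le_trans (ler_nat_andN _ h2) _.
  by rewrite -andbA; case: (_ && _).
rewrite expect_sum mulr_natr -sumr_const; apply: ler_sum => v _.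
rewrite !expectB expect_survives //.
rewrite !expect_sum; apply: lerB; last first.
  rewrite big_mkcond big_ord_recl /= add0r mulr_natl -[X in _ *+ X]card_ord -sumr_const.
  by apply: ler_sum => b _; apply: expect_link_sum_large.
rewrite lerD2l lerN2.
have F0 b : 0 <= (if (2 <= b)%N then pi ^+ b else 0) by case: ifP; rewrite ?exprn_ge0.
apply: le_trans (_ : \sum_(e in H | v \in e)
   (fun b => if (2 <= b)%N then pi ^+ b else 0) #|e|.-1 <= _).
  rewrite big_mkcond [leRHS]big_mkcond; apply: ler_sum => e _.
  case: (boolP (e \in H)) => //= eH; case: (boolP (v \in e)) => //= ve.
  have e1 := Hsparse.1 _ eH.
  have -> : (1 < #|e|.-1)%N = (2 < #|e|)%N by case: (#|e|) => [|[|[]]].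
  case: ifP => // _; rewrite expect_selected.
  by rewrite (cardsD1 v e) ve.
apply: le_trans (sum_link_sizes v Hsparse F0) _.
by rewrite -piM; apply: sum_binomial_tail; rewrite ?piM.
Qed.


Definition has_indep_ge (H' : {set {set T}}) (U' : {set T}) (x : R) :=
  exists S : {set T}, [/\ S \subset U', indep H' S & x <= #|S|%:R].

(** One outcome must serve both the present gain and the later rounds, so the first moment method is
    applied to the size of [selection] plus [beta] times that of [leftover]. No conditioning arises,
    since [leftover] is sparse for every outcome. *)
Lemma nibble_round (beta : R) : 0 <= beta ->
  (forall H' U', no_short_cycle H' ->
     sparse H' r (q * (1 + delta) * M) (y + theta) ->
     has_indep_ge H' U' (beta * #|U'|%:R)) ->
  has_indep_ge H U ((pi * (1 - 2 ^+ r * theta * y ^+ r) +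
     beta * (q - 2 ^+ r * theta ^+ 2 * y ^+ r - r%:R * (4 / (delta ^+ 2 * q * M))))
     * #|U|%:R).
Proof.
move=> beta0 IH.
have [w] := expect_attained p01 (fun w => #|selection w|%:R + beta * #|leftover w|%:R).
rewrite expectD expectZ => wE.
have [J [JV HJ cJ]] := IH _ (leftover w) (residual_no_short_cycle (selected w) (leftover w) Hcycle)
  (leftover_sparse w).
have selS : selection w \subset selected w.
  by apply/subsetP => u; rewrite /selection inE => /and3P[].
exists (selection w :|: J); split.
- rewrite subUset; apply/andP; split; apply/subsetP => u.
    by rewrite /selection inE => /andP[].
  by move/(subsetP JV)/leftoverP => [].
- exact: residual_indep selS (leftover_disjoint w) (@selection_indep w) JV HJ.
have -> : #|selection w :|: J| = (#|selection w| + #|J|)%N.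
  rewrite cardsU; suff -> : selection w :&: J = set0 by rewrite cards0 subn0.
  apply/eqP; rewrite setI_eq0 disjoint_sym.
  by apply: disjointWl JV _; apply: disjointWr selS (leftover_disjoint w).
rewrite natrD mulrDl.
apply: (@le_trans _ _ (#|selection w|%:R + beta * #|leftover w|%:R)); last by rewrite lerD2l.
apply: le_trans wE; apply: lerD; first exact: expect_selection_ge.
by rewrite -mulrA ler_wpM2l //; exact: expect_leftover_ge.
Qed.

End Round.

(** * Iterating the rounds *)

(** Induction on the number [s] of rounds left; [m <= q ^ s * M] keeps the degree scale above [m]
    throughout. A round selects a share [theta / M] and keeps at least half of it. The later gain
    [s / 4] suffers a relative loss [2 * delta = 1 / N], at most [1 / 4] in total, so a net
    [theta / (4 * M)] is added. *)
Lemma nibble_rounds (R : realFieldType) (T : finType) (r N : nat)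
    (Y theta q m : R) :
  let delta := (2 * N%:R)^-1 in
  (0 < r)%N -> (0 < N)%N -> 0 < theta -> theta <= 1 ->
  0 < q -> q <= 1 - 2 * r%:R * theta * Y ^+ r.-1 ->
  2 ^+ r * theta * Y ^+ r <= 1 / 2 ->
  2 ^+ r * theta ^+ 2 * Y ^+ r <= q * delta / 2 ->
  8 * r%:R <= delta ^+ 3 * q ^+ 2 * m -> 4 <= delta * m -> 1 <= q * m ->
  forall (s : nat) (H : {set {set T}}) (U : {set T}) (M y : R),
    (s <= N)%N -> m <= q ^+ s * M -> 1 <= y -> y + theta *+ s <= Y ->
    no_short_cycle H -> sparse H r M y ->
    has_indep_ge H U (theta *+ s / (4 * M) * #|U|%:R).
Proof.
move=> delta r0 N0 th0 th1 q0 qle S1 S2 m1 m2 m3.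
have N1 : 1 <= N%:R :> R by rewrite ler1n.
have d0 : 0 < delta by rewrite invr_gt0 mulr_gt0 // ltr0n.
have r1 : 1 <= r%:R :> R by rewrite ler1n.
have m0 : 0 < m by rewrite -(pmulr_rgt0 _ q0) (lt_le_trans ltr01).
elim=> [|s IH] H U M y sN mM y1 yY Hc Hs.
  exists set0; rewrite sub0set cards0 mulr0n !mul0r; split=> // e eH.
  by have := Hs.1 _ eH; rewrite subset0 -card_gt0 => /ltnW.
have Y1 : 1 <= Y by apply: le_trans yY; rewrite (le_trans y1) // lerDl mulrn_wge0 // ltW.
have Y0 : 0 <= Y by apply: le_trans Y1.
have yY' : y <= Y by apply: le_trans yY; rewrite lerDl mulrn_wge0 // ltW.
have y0 : 0 <= y by apply: le_trans y1.
have rthY : 0 <= 2 * r%:R * theta * Y ^+ r.-1 by rewrite !mulr_ge0 ?exprn_ge0 ?ler0n // ltW.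
have q1 : q <= 1 by apply: le_trans qle _; rewrite gerBl.
have M0 : 0 < M.
  by rewrite -(pmulr_rgt0 _ (exprn_gt0 s.+1 q0)); apply: lt_le_trans mM.
have mleM : m <= M.
  by apply: le_trans mM _; rewrite -[leRHS]mul1r ler_wpM2r ?(ltW M0) // exprn_ile1 // ltW.
have qM1 : 1 <= q * M by apply: le_trans m3 _; rewrite ler_wpM2l // ltW.
have M1 : 1 <= M by apply: le_trans qM1 _; rewrite -[leRHS]mul1r ler_wpM2r // ltW.
have dM : 4 <= delta * M by apply: le_trans m2 _; rewrite ler_wpM2l // ltW.
have d1 : delta <= 1 / 2.
  by rewrite /delta invfM div1r -[leRHS]mulr1 ler_wpM2l ?invr_ge0 // invf_le1 // ltr0n.
have pid : theta / M <= delta / 4.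
  by rewrite ler_pdivrMr // mulrAC ler_pdivlMr //; lra.
have pi0 : 0 < theta / M by rewrite divr_gt0.
have pi1 : theta / M < 1 by lra.
have yYr k : y ^+ k <= Y ^+ k by rewrite lerXn2r // nnegrE.
have qle' : q <= 1 - theta / M * (1 + r%:R * M * y ^+ r.-1).
  apply: le_trans qle _; rewrite lerD2l lerN2.
  have -> : theta / M * (1 + r%:R * M * y ^+ r.-1) = theta / M + r%:R * theta * y ^+ r.-1.
    by field; rewrite gt_eqF.
  have Yr1 : 1 <= Y ^+ r.-1 by rewrite exprn_ege1.
  have thM : theta / M <= theta by rewrite ler_pdivrMr // ler_peMr // ltW.
  have A1 : r%:R * theta * y ^+ r.-1 <= r%:R * theta * Y ^+ r.-1.
    by rewrite ler_wpM2l // mulr_ge0 ?ler0n // ltW.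
  have A2 : theta <= r%:R * theta * Y ^+ r.-1.
    rewrite -[leLHS]mulr1; apply: ler_pM => //; first exact: ltW.
    by rewrite ler_peMl // ltW.
  have -> : 2 * r%:R * theta * Y ^+ r.-1 = r%:R * theta * Y ^+ r.-1 + r%:R * theta * Y ^+ r.-1 by ring.
  by apply: lerD => //; exact: le_trans A2.
have dpi : 1 + delta / 2 <= (1 + delta) * (1 - theta / M).
  have : delta * (theta / M) <= 1 / 2 * (theta / M) by rewrite ler_wpM2r // ltW.
  by lra.
pose M' := q * (1 + delta) * M.
have d1' : 0 < 1 + delta by rewrite addr_gt0.
have M'0 : 0 < M' by rewrite !mulr_gt0.
have beta0 : 0 <= theta *+ s / (4 * M').
  by rewrite divr_ge0 ?mulrn_wge0 // ?(ltW th0) // mulr_ge0 // ltW.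
have := nibble_round U Hc Hs M0 y1 th0 th1 pi1 q0 d0 qle' qM1 dpi beta0.
case=> [H' U' Hc' Hs'|S [SU HS cS]].
  apply: (IH H' U' M' (y + theta)) => //; first exact: ltnW.
  - apply: le_trans mM _; rewrite exprSr -mulrA ler_wpM2l ?exprn_ge0 ?(ltW q0) //.
    by rewrite /M' ler_wpM2r ?(ltW M0) // ler_peMr ?(ltW q0) // lerDl ltW.
  - by rewrite (le_trans y1) // lerDl ltW.
  - by rewrite -addrA -mulrS.
exists S; split=> //; apply: le_trans cS; rewrite ler_wpM2r //.
set S2' := 2 ^+ r * theta ^+ 2 * y ^+ r; set eta := r%:R * _.
have hS1 : 2 ^+ r * theta * y ^+ r <= 1 / 2.
  by apply: le_trans S1; rewrite ler_wpM2l // mulr_ge0 ?exprn_ge0 // ltW.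
have hS2 : S2' <= q * delta / 2.
  by apply: le_trans S2; rewrite ler_wpM2l // mulr_ge0 ?exprn_ge0 // ltW.
have heta : eta <= q * delta / 2.
  rewrite /eta mulrA ler_pdivrMr; last by rewrite !mulr_gt0 // exprn_gt0.
  have -> : q * delta / 2 * (delta ^+ 2 * q * M) = (delta ^+ 3 * q ^+ 2 * M) / 2 by field.
  suff : 8 * r%:R <= delta ^+ 3 * q ^+ 2 * M by lra.
  by apply: le_trans m1 _; rewrite ler_wpM2l // mulr_ge0 ?exprn_ge0 // ltW.
(* The vertex set shrinks by about [q] and [M] by [q * (1 + delta)], so their ratio loses only a
   factor [1 - 2 * delta]. *)
have main : 1 - 2 * delta <= (q - S2' - eta) / (q * (1 + delta)).
  rewrite ler_pdivlMr ?mulr_gt0 //.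
  have -> : (1 - 2 * delta) * (q * (1 + delta)) = q - q * delta - 2 * q * delta ^+ 2 by ring.
  have : 0 <= 2 * q * delta ^+ 2 by rewrite !mulr_ge0 ?exprn_ge0 // ltW.
  by lra.
have sdel : s%:R * (2 * delta) <= 1.
  have -> : 2 * delta = N%:R^-1 by rewrite /delta; field; rewrite gt_eqF // (lt_le_trans ltr01).
  by rewrite ler_pdivrMr ?mul1r ?ltr0n // ler_nat ltnW.
have -> : theta *+ s / (4 * M') * (q - S2' - eta) =
  theta / M * (s%:R / 4 * ((q - S2' - eta) / (q * (1 + delta)))).
  by rewrite /M' -mulr_natr; field; rewrite !gt_eqF.
rewrite -mulrDr.
have -> : theta *+ s.+1 / (4 * M) = theta / M * ((s%:R + 1) / 4).
  by rewrite -mulr_natr -natr1; field; rewrite gt_eqF.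
rewrite ler_wpM2l ?(ltW pi0) //.
have : s%:R / 4 * (1 - 2 * delta) <= s%:R / 4 * ((q - S2' - eta) / (q * (1 + delta))).
  by rewrite ler_wpM2l // divr_ge0.
by set z := (q - S2' - eta) / _; move: hS1 sdel; lra.
Qed.

(** * Minimal tight families *)

Section Tight.
Variables (n k r g : nat).
Implicit Types (K A B e f : {set {set 'I_n}}).

(* With i = r + 1 and j = k + g, tight means |cover A| - k = (|A| - 1) g / r, so
   that i edges spanning exactly j vertices are tight; overdense means that
   |cover A| is smaller. *)
Definition overdense A := (r * #|cover A| + g < r * k + #|A| * g)%N.
Definition tight A := (r * #|cover A| + g == r * k + #|A| * g)%N.

Definition min_tight K : {set {set {set 'I_n}}} :=
  [set A : {set {set 'I_n}} | [&& A \subset K, (1 < #|A|)%N, (#|A| <= r.+1)%N, tight A &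
     [forall B : {set {set 'I_n}}, (B \proper A) && (1 < #|B|)%N ==> ~~ tight B]]].

Lemma min_tightP K (A : {set {set 'I_n}}) : reflect
  [/\ A \subset K, (1 < #|A|)%N, (#|A| <= r.+1)%N, tight A &
      forall B, B \subset A -> (1 < #|B|)%N -> tight B -> B = A]
  (A \in min_tight K).
Proof.
rewrite inE; apply: (iffP and5P) => [[AK A1 Ar tA /forallP mA]|[AK A1 Ar tA mA]].
  split=> // B BA B1 tB; apply/eqP; move: (mA B); rewrite B1 andbT tB implybF.
  by rewrite properEneq BA andbT negbK.
split=> //; apply/forallP => B; apply/implyP => /andP[BA B1]; apply/negP => tB.
by have BE := mA B (proper_sub BA) B1 tB; move: BA; rewrite BE properxx.
Qed.

Variable K : {set {set 'I_n}}.
(** The bound [4 * r.+1] is the size of a union of four minimal tight families, as met in a cycle of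
    length 4. *)
Hypothesis K_over : forall A, A \subset K -> (0 < #|A|)%N ->
  (#|A| <= 4 * r.+1)%N -> ~~ overdense A.

(* Submodularity: cover A and cover B meet in at least the vertices covered by
   the intersection of A and B. *)
Lemma tightUI A B : A \subset K -> B \subset K -> A :&: B != set0 ->
  tight A -> tight B -> (#|A :|: B| <= 4 * r.+1)%N ->
  tight (A :|: B) /\ tight (A :&: B).
Proof.
move=> AK BK AB0 /eqP tA /eqP tB ABN.
have AB1 : (0 < #|A :&: B|)%N by rewrite card_gt0.
have AU := subset_leq_card (subsetIl A B); have UA := subset_leq_card (subsetUl A B).
have hU : ~~ overdense (A :|: B).
  by apply: K_over; rewrite ?subUset ?AK // (leq_trans AB1) // (leq_trans AU).
have hI : ~~ overdense (A :&: B).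
  apply: K_over => //; first exact: subset_trans (subsetIl _ _) AK.
  exact: leq_trans AU (leq_trans UA ABN).
have cU : cover (A :|: B) = cover A :|: cover B by rewrite /cover bigcup_setU.
have cI : (#|cover (A :&: B)| <= #|cover A :&: cover B|)%N.
  apply: subset_leq_card; apply/subsetP => x /bigcupP[e /setIP[eA eB] xe].
  by apply/setIP; split; apply/bigcupP; exists e.
have cc : (#|cover (A :|: B)| + #|cover (A :&: B)| <= #|cover A| + #|cover B|)%N.
  by rewrite cU -[leqRHS]cardsUI leq_add2l.
have cAB := cardsUI A B.
have rcc := leq_mul (leqnn r) cc; rewrite !mulnDr in rcc.
have gAB := congr1 (muln^~ g) cAB; rewrite /= !mulnDl in gAB.
move: hU hI; rewrite /overdense /tight -!leqNgt.
move=> hU hI.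
have squeeze (x y u i c a b u' i' : nat) : (x + g = c + a -> y + g = c + b ->
    u + i <= x + y -> u' + i' = a + b -> c + u' <= u + g -> c + i' <= i + g ->
    u + g = c + u' /\ i + g = c + i')%N by clear; lia.
by have [/eqP-> /eqP->] := squeeze _ _ _ _ _ _ _ _ _ tA tB rcc gAB hU hI.
Qed.

Hypothesis rg : ~~ (r %| g)%N.

(** For two members tightness reads [g = r * (#|cover A| - k)], making [r] a divisor of [g]. *)
Lemma min_tight_size A : A \in min_tight K -> (2 < #|A|)%N.
Proof.
move=> /min_tightP[_ A1 _ /eqP tA _]; rewrite ltn_neqAle A1 andbT.
apply: contraNneq rg => A2; move: tA; rewrite -A2 => tA.
have -> : g = (r * #|cover A| - r * k)%N by lia.
by rewrite -mulnBr dvdn_mulr.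
Qed.

(** The intersection of [e] and [B] is tight and has two members, so minimality of [e] makes it all
    of [e]. *)
Lemma min_tight_sub e B x y : e \in min_tight K -> B \subset K -> tight B ->
  (#|e :|: B| <= 4 * r.+1)%N -> x != y ->
  x \in e -> y \in e -> x \in B -> y \in B -> e \subset B.
Proof.
move=> /min_tightP[eK _ _ te me] BK tB eBN xy xe ye xB yB.
have eB0 : e :&: B != set0 by apply/set0Pn; exists x; rewrite inE xe.
have [_ tI] := tightUI eK BK eB0 te tB eBN.
have I2 : (1 < #|e :&: B|)%N.
  have := subset_leq_card (_ : [set x; y] \subset e :&: B); rewrite cards2 xy; apply.
  by rewrite subUset !sub1set !inE xe ye xB yB.
by rewrite -(me _ (subsetIl e B) I2 tI) subsetIr.
Qed.

(** The union of all edges of a cycle but one is tight and shares two members with the last edge,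
    hence contains it. The absence of shorter cycles then leaves the last edge with only those two
    members, against the minimum of three. *)
Lemma min_tight_no_short_cycle : no_short_cycle (min_tight K).
Proof.
have C2 e f x y : e \in min_tight K -> f \in min_tight K -> x != y ->
    x \in e -> y \in e -> x \in f -> y \in f -> e = f.
  move=> eH fH xy xe ye xf yf; apply/eqP; rewrite eqEsubset.
  have /min_tightP[eK _ er te _] := eH; have /min_tightP[fK _ fr tf _] := fH.
  have cU : (#|e :|: f| <= 4 * r.+1)%N.
    by have := (leq_card_setU e f).1; move: er fr; clear; lia.
  rewrite (min_tight_sub eH fK tf cU xy) //.
  by rewrite (min_tight_sub fH eK te _ xy) // setUC.
have small (h : {set {set 'I_n}}) x z : h \in min_tight K ->
    (forall t, t \in h -> t = x \/ t = z) -> False.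
  move=> hH hE; have := min_tight_size hH; apply/negP; rewrite -leqNgt.
  apply: leq_trans (_ : #|[set x; z]| <= _)%N; last by rewrite cards2; case: (_ == _).
  apply: subset_leq_card; apply/subsetP => t /hE[->|->]; by rewrite !inE eqxx ?orbT.
have tU e f x : e \in min_tight K -> f \in min_tight K -> x \in e -> x \in f ->
    [/\ e :|: f \subset K, tight (e :|: f) & (#|e :|: f| <= 2 * r.+1)%N].
  move=> eH fH xe xf; have /min_tightP[eK _ er te _] := eH; have /min_tightP[fK _ fr tf _] := fH.
  have cU : (#|e :|: f| <= 2 * r.+1)%N.
    by have := (leq_card_setU e f).1; move: er fr; clear; lia.
  split=> //; first by rewrite subUset eK.
  have ef0 : e :&: f != set0 by apply/set0Pn; exists x; rewrite inE xe.
  have [] // := tightUI eK fK ef0 te tf; apply: leq_trans cU _.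
  by rewrite leq_mul2r orbT.
have C3 e f h x y z : e \in min_tight K -> f \in min_tight K -> h \in min_tight K ->
    x != y -> y != z -> z != x ->
    x \in e -> y \in e -> y \in f -> z \in f -> z \in h -> x \in h -> e = f.
  move=> eH fH hH xy yz zx xe ye yf zf zh xh; apply/eqP/negPn/negP => ef.
  have he : h != e by apply: contraNneq ef => hE; rewrite (C2 e f y z) // -hE.
  have hf : h != f.
    apply: contraNneq ef => hE; rewrite (C2 e f x y) //; first by rewrite -hE.
  have [efK tef efc] := tU _ _ _ eH fH ye yf.
  have cU : (#|h :|: (e :|: f)| <= 4 * r.+1)%N.
    have /min_tightP[_ _ hr _ _] := hH.
    by have := (leq_card_setU h (e :|: f)).1; move: hr efc; clear; lia.
  have hef : h \subset e :|: f.
    by apply: (min_tight_sub hH efK tef cU zx) => //; rewrite inE ?zf ?xe ?orbT.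
  apply: (small h x z hH) => t th; case/setUP: (subsetP hef _ th) => [te|tf].
    left; apply/eqP; apply: contraNT he => tx.
    by rewrite (C2 h e t x).
  right; apply/eqP; apply: contraNT hf => tz.
  by rewrite (C2 h f t z).
split=> // e f h l x y z w eH fH hH lH xy yz zw wx xz yw xe ye yf zf zh wh wl xl.
have [->|ef] := eqVneq e f; first by constructor 1.
have [->|fh] := eqVneq f h; first by constructor 2.
have [->|hl] := eqVneq h l; first by constructor 3.
have [->|le] := eqVneq l e; first by constructor 4.
exfalso.
have eh : e != h.
  by apply: contraNneq ef => E; rewrite (C2 e f y z) // E.
have fl : f != l.
  by apply: contraNneq ef => E; rewrite (C2 e f x y) // E.
have [efK tef efc] := tU _ _ _ eH fH ye yf.
have /min_tightP[hK _ hr th _] := hH; have /min_tightP[_ _ lr _ _] := lH.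
have efh0 : (e :|: f) :&: h != set0.
  by apply/set0Pn; exists z; rewrite !inE zf zh orbT.
have cefh : (#|(e :|: f) :|: h| <= 4 * r.+1)%N.
  by have := (leq_card_setU (e :|: f) h).1; move: hr efc; clear; lia.
have [tefh _] := tightUI efK hK efh0 tef th cefh.
have efhK : (e :|: f) :|: h \subset K by rewrite subUset efK.
have cU : (#|l :|: ((e :|: f) :|: h)| <= 4 * r.+1)%N.
  have := (leq_card_setU l ((e :|: f) :|: h)).1; have := (leq_card_setU (e :|: f) h).1.
  by move: hr lr efc; clear; lia.
have lefh : l \subset (e :|: f) :|: h.
  by apply: (min_tight_sub lH efhK tefh cU wx) => //; rewrite !inE ?wh ?xe ?orbT.
have le_x t : t \in l -> t \in e -> t = x.
  move=> tl te'; apply/eqP; apply: contraNT le => tx.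
  by rewrite (C2 l e t x).
apply: (small l x w lH) => t tl; case/setUP: (subsetP lefh _ tl) => [|tH]; last first.
  right; apply/eqP; apply: contraNT hl => tw.
  by rewrite (C2 h l t w).
(* A further member [t] in [f] would close a triangle of [l], [f] and [e] through [t], [y] and
   [x]. *)
case/setUP => [te'|tf']; first by left; exact: le_x.
have [->|tx] := eqVneq t x; [by left | exfalso].
have ty : t != y.
  by apply: contraNneq tx => tyE; apply/eqP/le_x; rewrite // tyE.
move/eqP: fl; apply; apply/esym.
by apply: (C3 l f e x t y) => //; rewrite eq_sym.
Qed.

(** For [r + 1] sets, not being overdense means spanning at least [k + g] vertices, so equality
    holds in a dense set and a minimal tight subfamily lies in [I]. *)
Lemma indep_min_tight_not_dense (I : {set {set 'I_n}}) : (0 < r)%N ->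
  I \subset K -> indep (min_tight K) I ->
  ~~ has_dense_set (k + g) r.+1 I.
Proof.
move=> r0 IK HI; apply/negP => /existsP[S /andP[/eqP cS]].
set D := [set e in I | e \subset S] => Dr.
have [A AD cA] : exists2 A : {set {set 'I_n}}, A \subset D & #|A| = r.+1.
  have : (0 < #|[set A : {set {set 'I_n}} | A \subset D & #|A| == r.+1]|)%N.
    by rewrite cards_draws bin_gt0.
  by case/card_gt0P => A; rewrite inE => /andP[AD /eqP cA]; exists A.
have AI : A \subset I.
  by apply: subset_trans AD _; apply/subsetP => e; rewrite inE => /andP[].
have cov : (#|cover A| <= k + g)%N.
  rewrite -cS; apply: subset_leq_card; apply/bigcupsP => e /(subsetP AD).
  by rewrite inE => /andP[].
have tA : tight A && (1 < #|A|)%N.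
  have : ~~ overdense A.
    apply: K_over; [exact: subset_trans IK | by rewrite cA | rewrite cA; lia].
  rewrite /overdense /tight cA -leqNgt => h; apply/andP; split.
    apply/eqP; have : (r * #|cover A| <= r * (k + g))%N by rewrite leq_mul2l cov orbT.
    by move: h; clear; lia.
  by rewrite ltnS.
have [B /minsetP[/andP[tB B1] mB] BA] := minset_exists tA (P := fun B => tight B && (1 < #|B|)%N).
have BH : B \in min_tight K.
  apply/min_tightP; split=> //.
  - exact: subset_trans (subset_trans BA AI) IK.
  - by rewrite -cA subset_leq_card.
  - by move=> C CB C1 tC; apply: mB; rewrite ?tC.
by move: (HI _ BH); rewrite (subset_trans BA AI).
Qed.

End Tight.

(** * The random sample *)

Lemma leq_card_bigcup (I T : finType) (P : pred I) (F : I -> {set T}) :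
  (#|\bigcup_(i | P i) F i| <= \sum_(i | P i) #|F i|)%N.
Proof.
apply: (big_ind2 (fun (A : {set T}) m => #|A| <= m)%N) => [|A a B b Aa Bb|//].
  by rewrite cards0.
by apply: leq_trans (leq_card_setU A B).1 _; exact: leq_add.
Qed.

(** A family is a set of subsets of its cover: at most [n ^ s] covers, and a number of families on
    each that does not depend on [n]. *)
Lemma card_families_cover (n s : nat) :
  (#|[set A : {set {set 'I_n}} | #|cover A| == s]| <= n ^ s * 2 ^ (2 ^ s))%N.
Proof.
apply: (@leq_trans #|\bigcup_(S : {set 'I_n} | #|S| == s) powerset (powerset S)|).
  apply: subset_leq_card; apply/subsetP => A; rewrite inE => As.
  apply/bigcupP; exists (cover A) => //; rewrite inE; apply/subsetP => e eA.
  by rewrite inE; exact: bigcup_sup.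
apply: leq_trans (leq_card_bigcup _ _) _.
rewrite (eq_bigr (fun=> 2 ^ (2 ^ s))%N) => [|S /eqP sS]; last first.
  by rewrite !card_powerset sS.
rewrite sum_nat_const leq_mul2r; apply/orP; right.
rewrite -cardsE card_draws card_ord; apply: (@leq_trans (n ^_ s)).
  by rewrite -bin_ffact leq_pmulr ?fact_gt0.
rewrite ffact_prod -[s in (_ ^ s)%N]card_ord -prod_nat_const.
by apply: leq_prod => i _; exact: leq_subr.
Qed.

Lemma expn_leq_bin (n k : nat) : (2 * k <= n)%N ->
  (n ^ k <= 2 ^ k * k`! * 'C(n, k))%N.
Proof.
move=> kn; rewrite -mulnA [(k`! * _)%N]mulnC bin_ffact ffact_prod.
rewrite -[k in (n ^ k)%N]card_ord -[k in (2 ^ k)%N]card_ord -!prod_nat_const -big_split.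
by apply: leq_prod => i _ /=; have := ltn_ord i; move: kn; clear; lia.
Qed.

Lemma expect_subset (R : realFieldType) (I : finType) (p : R) (A : {set I}) :
  expect (fun=> p) (fun w => (A \subset w)%:R) = p ^+ #|A|.
Proof.
have d0 (w : {set I}) : [disjoint set0 & w] by rewrite disjoints_subset sub0set.
transitivity (expect (fun=> p) (cyl R A set0)).
  by apply: expect_ext => w; rewrite /cyl d0 andbT.
by rewrite expect_cyl 1?disjoint_sym // big_set0 mulr1 prodr_const.
Qed.

Section Sampling.
Variables (R : realFieldType) (n k r g V : nat) (b L : R).

(* The sampling density n ^ (eps - g / r), where b = n ^ eps and eps = 1 / (r V). *)
Let p := b / b ^+ (V * g).
Let ksets : {set {set 'I_n}} := [set e : {set 'I_n} | #|e| == k].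

(** A constant independent of [n], bounding the number of families of at most [V] sets of size [k]
    when each is weighted by [n ^ (- #|cover A|)]. *)
Definition family_weight : R := \sum_(s < (k * V).+1) (2 ^ (2 ^ s))%:R.

Hypothesis V_eq : V = (4 * r.+1)%N.
Hypotheses (n0 : (0 < n)%N) (r0 : (0 < r)%N) (g0 : (0 < g)%N).
Hypotheses (b1 : 1 <= b) (bn : b ^+ (r * V) = n%:R) (L1 : 1 <= L).

Let b0 : 0 < b. Proof. exact: lt_le_trans ltr01 b1. Qed.
Let nR0 : 0 < n%:R :> R. Proof. by rewrite ltr0n. Qed.
Let p0 : 0 < p. Proof. by rewrite divr_gt0 ?exprn_gt0. Qed.
Let L0 : 0 < L. Proof. exact: lt_le_trans ltr01 L1. Qed.

Lemma sum_families_le :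
  \sum_(A : {set {set 'I_n}} | (A \subset ksets) && (#|A| <= V)%N)
     (n%:R ^+ #|cover A|)^-1 <= family_weight.
Proof.
rewrite (partition_big (fun A : {set {set 'I_n}} => inord #|cover A| : 'I_(k * V).+1) xpredT) //=.
apply: ler_sum => s _.
apply: (@le_trans _ _ (\sum_(A in [set A : {set {set 'I_n}} | #|cover A| == s]) (n%:R ^+ s)^-1)).
  rewrite [leLHS]big_mkcond [leRHS]big_mkcond; apply: ler_sum => A _.
  case: ifP => [/andP[/andP[AK AV] /eqP sA]|_]; last first.
    by case: ifP => // _; rewrite invr_ge0 exprn_ge0 // ltW.
  have cA : (#|cover A| <= k * V)%N.
    apply: leq_trans (leq_card_cover A).1 _.
    rewrite (eq_bigr (fun=> k)) => [|e /(subsetP AK)]; last by rewrite inE => /eqP.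
    by rewrite sum_nat_const mulnC leq_mul2l AV orbT.
  have -> : #|cover A| = s by rewrite -sA inordK.
  by rewrite inE -sA inordK // eqxx.
rewrite sumr_const -[leLHS]mulr_natl ler_pdivrMr ?exprn_gt0 //.
by rewrite -natrX -natrM ler_nat; rewrite [leqRHS]mulnC card_families_cover.
Qed.

(** The strict integer inequality is worth [n ^ (- 1 / r)], which offsets
    [b ^ #|A| <= b ^ V = n ^ (1 / r)]. The result is below the scale [n ^ k * p] of the sample size
    by a factor [b]. *)
Lemma overdense_weight (A : {set {set 'I_n}}) : (#|A| <= V)%N -> overdense k r g A ->
  p ^+ #|A| <= n%:R ^+ k / b ^+ (V * g) * (n%:R ^+ #|cover A|)^-1.
Proof.
move=> AV oA; rewrite ler_pdivlMr ?exprn_gt0 // ler_pdivlMr ?exprn_gt0 //.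
rewrite -bn -!exprM expr_div_n -exprM -mulrA mulrAC ler_pdivrMr ?exprn_gt0 // mulrA.
rewrite -!exprD ler_weXn2l //; have : (V * (r * #|cover A| + g).+1 <= V * (r * k + #|A| * g))%N.
  by rewrite leq_mul2l; apply/orP; right.
rewrite mulnS !mulnDr (mulnC #|A| g) (mulnC r V) -!mulnA.
by move: (V * (r * _))%N (V * g)%N (V * (r * k))%N (V * (g * _))%N AV; clear; lia.
Qed.

(** The powers [n ^ (g / r)] cancel exactly for a tight family, leaving the excess density [b] once
    per member beyond the first. *)
Lemma tight_weight (A : {set {set 'I_n}}) : (0 < #|A|)%N -> tight k r g A ->
  p ^+ #|A| = n%:R ^+ k * p * b ^+ #|A|.-1 * (n%:R ^+ #|cover A|)^-1.
Proof.
move=> A0 /eqP tA.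
have e : (V * (r * #|cover A| + g) = V * (r * k + #|A| * g))%N by rewrite tA.
have bX m : b ^+ m != 0 by rewrite expf_neq0 // gt_eqF.
have NE m : n%:R ^+ m = b ^+ (r * V * m) by rewrite exprM bn.
have aux1 (x y z B N D : R) : B != 0 -> N != 0 ->
    x * (z / B) * y / N * N * B * D = x * z * y * D.
  by move=> B0 N0; field; rewrite B0 N0.
have aux2 (x N B D : R) : D != 0 -> x / D * N * B * D = x * N * B.
  by move=> D0; field.
apply: (mulIf (bX (r * V * #|cover A|)%N)); apply: (mulIf (bX (V * g)%N)).
apply: (mulIf (bX (V * g * #|A|)%N)).
rewrite !NE /p aux1 // expr_div_n -(exprM b) aux2 //.
rewrite -(mulrA _ b) -exprS prednK // -!exprD; congr (_ ^+ _).
move: e; rewrite !mulnDr (mulnC #|A| g) (mulnC r V) -!mulnA.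
by move: (V * (r * _))%N (V * g)%N (V * (r * k))%N (V * (g * _))%N; clear; lia.
Qed.


Definition is_over (A : {set {set 'I_n}}) :=
  [&& A \subset ksets, (0 < #|A|)%N, (#|A| <= V)%N & overdense k r g A].

Definition is_tight (A : {set {set 'I_n}}) :=
  [&& A \subset ksets, (1 < #|A|)%N, (#|A| <= r.+1)%N & tight k r g A].

(** A charge of at most 1 bounds all degrees at once, by [L * b ^ l] for families of [l + 1]
    members. Counting every tight family, minimal or not, only increases it. *)
Definition charge (w : {set {set 'I_n}}) (v : {set 'I_n}) : R :=
  \sum_(A : {set {set 'I_n}} | is_tight A && (v \in A))
     (A \subset w)%:R / (L * b ^+ #|A|.-1).

(** Bounds from below what is left after deleting one member of each overdense family and every set
    of charge above 1; there are no more of the latter than the total charge. *)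
Definition sample_value (w : {set {set 'I_n}}) : R :=
  #|w :&: ksets|%:R - \sum_(A | is_over A) (A \subset w)%:R - \sum_v charge w v.

Lemma expect_sample_value :
  'C(n, k)%:R * p - n%:R ^+ k / b ^+ (V * g) * family_weight
    - n%:R ^+ k * p * (r.+1%:R / L) * family_weight <= expect (fun=> p) sample_value.
Proof.
rewrite /sample_value !expectB !expect_sum; apply: lerB; first apply: lerB.
- have -> : expect (fun=> p) (fun w => #|w :&: ksets|%:R) =
      \sum_(e in ksets) expect (fun=> p) (fun w => ([set e] \subset w)%:R).
    rewrite -expect_sum; apply: expect_ext => w; rewrite -sum1_card natr_sum.
    rewrite [LHS]big_mkcond [RHS]big_mkcond; apply: eq_bigr => e _.
    by rewrite sub1set inE andbC; case: (e \in ksets); case: (e \in w).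
  rewrite (eq_bigr (fun=> p)) => [|e _]; last by rewrite expect_subset cards1 expr1.
  by rewrite sumr_const cardsE -(cardsE (fun e : {set 'I_n} => #|e| == k)) card_draws card_ord mulr_natl.
- have c0 : 0 <= n%:R ^+ k / b ^+ (V * g) by rewrite divr_ge0 ?exprn_ge0 ?(ltW b0).
  apply: le_trans (ler_wpM2l c0 sum_families_le).
  rewrite mulr_sumr big_mkcond [leRHS]big_mkcond; apply: ler_sum => A _.
  rewrite expect_subset /is_over.
  case: (boolP (A \subset ksets)) => //= _; case: (boolP (#|A| <= V)%N) => AV; rewrite ?andbF //=.
  case: ifP => [/andP[_ oA]|_]; first exact: overdense_weight.
  by rewrite mulr_ge0 ?divr_ge0 ?invr_ge0 ?exprn_ge0 // ltW.
(* Double counting: a tight family contributes to the charge of each of its [#|A|] members. *)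
have -> : \sum_v expect (fun=> p) (charge^~ v) =
    \sum_(A | is_tight A) #|A|%:R * (p ^+ #|A| / (L * b ^+ #|A|.-1)).
  transitivity (\sum_v \sum_(A | is_tight A && (v \in A)) p ^+ #|A| / (L * b ^+ #|A|.-1)).
    apply: eq_bigr => v _; rewrite /charge expect_sum; apply: eq_bigr => A _.
    rewrite -expect_subset [RHS]mulrC -expectZ; apply: expect_ext => w; exact: mulrC.
  rewrite (exchange_big_dep is_tight) /=; last by move=> v A _ /andP[].
  apply: eq_bigr => A tA; rewrite mulr_natl -sumr_const.
  by apply: eq_bigl => v; rewrite tA.
have c0 : 0 <= n%:R ^+ k * p * (r.+1%:R / L).
  apply: mulr_ge0; last by rewrite divr_ge0 ?ler0n ?(ltW L0).
  by apply: mulr_ge0; rewrite ?exprn_ge0 // ltW.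
apply: le_trans (ler_wpM2l c0 sum_families_le).
rewrite mulr_sumr big_mkcond [leRHS]big_mkcond; apply: ler_sum => A _.
have rhs0 : 0 <= n%:R ^+ k * p * (r.+1%:R / L) / n%:R ^+ #|cover A|.
  by rewrite mulr_ge0 ?invr_ge0 ?exprn_ge0.
case: ifP => [/and4P[AK A1 Ar tA]|_]; last by case: ifP.
have A0 : (0 < #|A|)%N by exact: ltnW.
rewrite AK (leq_trans Ar) /=; last by rewrite V_eq; clear; lia.
rewrite tight_weight // [leLHS](_ : _ = n%:R ^+ k * p * (#|A|%:R / L) / n%:R ^+ #|cover A|); last first.
  have aux (x y z u N B : R) : B != 0 -> x * (y * z * B * N^-1 / (u * B)) = y * z * (x / u) / N.
    move=> B0; rewrite invfM; have -> : y * z * B * N^-1 * (u^-1 / B) = y * z * N^-1 * u^-1 * (B / B) by rewrite !mulrA; ring.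
    by rewrite divff // mulr1; ring.
  by apply: aux; rewrite expf_neq0 // gt_eqF.
rewrite ler_wpM2r ?invr_ge0 ?exprn_ge0 ?(ltW nR0) //.
apply: ler_wpM2l; first by apply: mulr_ge0; rewrite ?exprn_ge0 // ltW.
by rewrite ler_wpM2r ?invr_ge0 ?(ltW L0) // ler_nat.
Qed.

Lemma clean_sample (w : {set {set 'I_n}}) : exists K : {set {set 'I_n}},
  [/\ K \subset ksets,
      forall A : {set {set 'I_n}}, A \subset K -> (0 < #|A|)%N -> (#|A| <= 4 * r.+1)%N -> ~~ overdense k r g A,
      forall v l, (deg (min_tight k r g K) v l)%:R <= L * b ^+ l
    & sample_value w <= #|K|%:R].
Proof.
have charge_ge0 v : 0 <= charge w v.
  by apply: sumr_ge0 => A _; rewrite divr_ge0 ?mulr_ge0 ?exprn_ge0 // ltW.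
(* The member to delete; the default [set0] is never reached for nonempty families. *)
pose h (A : {set {set 'I_n}}) := odflt set0 [pick x in A].
have hA (A : {set {set 'I_n}}) : (0 < #|A|)%N -> h A \in A.
  by rewrite card_gt0 /h; case: pickP => [//|A0 /set0Pn[x]]; rewrite A0.
pose Ov := [set A : {set {set 'I_n}} | is_over A & A \subset w].
pose Bad := [set v : {set 'I_n} | 1 < charge w v].
exists (((w :&: ksets) :\: Bad) :\: (h @: Ov)); set K := _ :\: _.
have Kw : K \subset w.
  by apply/subsetP => v; rewrite /K !inE => /andP[_ /and3P[]].
have Kk : K \subset ksets.
  by apply/subsetP => v /setDP[/setDP[/setIP[]]].
split=> //.
- move=> A AK A0 AV; apply/negP => oA.
  have AO : A \in Ov.
    by rewrite inE (subset_trans AK Kw) andbT /is_over (subset_trans AK Kk) A0 V_eq AV.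
  have /setDP[_] := subsetP AK _ (hA A A0).
  by rewrite imset_f.
- move=> v l.
  have Lb : 0 < L * b ^+ l by rewrite mulr_gt0 ?exprn_gt0.
  have [vK|vK] := boolP (v \in K); last first.
    suff -> : deg (min_tight k r g K) v l = 0%N by exact: ltW.
    apply/eqP; rewrite cards_eq0; apply/eqP/setP => A; rewrite [RHS]inE.
    apply/negbTE/negP; rewrite inE => /and3P[/min_tightP[AK _ _ _ _] vA _].
    by rewrite (subsetP AK _ vA) in vK.
  have ch1 : charge w v <= 1.
    by have /setDP[/setDP[_]] := vK; rewrite inE -leNgt.
  rewrite -[leRHS]mul1r -ler_pdivrMr //; apply: le_trans ch1.
  rewrite /deg -sum1_card natr_sum mulr_suml /charge [leLHS]big_mkcond [leRHS]big_mkcond.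
  apply: ler_sum => A _; rewrite inE; case: ifP => [/and3P[/min_tightP[AK A1 Ar tA _] vA /eqP Al]|_].
    by rewrite /is_tight (subset_trans AK Kk) A1 Ar tA vA /= (subset_trans AK Kw) Al.
  by case: ifP => // _; rewrite divr_ge0 ?mulr_ge0 ?exprn_ge0 // ltW.
have cOv : #|Ov|%:R = \sum_(A | is_over A) (A \subset w)%:R :> R.
  rewrite -sum1_card natr_sum [LHS]big_mkcond [RHS]big_mkcond; apply: eq_bigr => A _.
  by rewrite inE; case: (is_over A); case: (_ \subset _).
have cBad : #|Bad|%:R <= \sum_v charge w v.
  rewrite -sum1_card natr_sum [leLHS]big_mkcond; apply: ler_sum => v _.
  by rewrite inE; case: ifP => // /ltW.
have cK : #|w :&: ksets|%:R <= #|K|%:R + #|Ov|%:R + #|Bad|%:R :> R.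
  rewrite -!natrD ler_nat.
  have c1 := cardsID Bad (w :&: ksets).
  have c2 := cardsID (h @: Ov) ((w :&: ksets) :\: Bad).
  have c3 := subset_leq_card (subsetIr (w :&: ksets) Bad).
  have c4 : (#|((w :&: ksets) :\: Bad) :&: (h @: Ov)| <= #|Ov|)%N.
    exact: leq_trans (subset_leq_card (subsetIr _ _)) (leq_imset_card _ _).
  by rewrite -c1 -c2 [leqLHS]addnC leq_add // [leqLHS]addnC leq_add.
by rewrite /sample_value -cOv; lra.
Qed.

End Sampling.

Lemma sparse_sample (R : realFieldType) (k r g : nat) :
  (0 < r)%N -> (0 < g)%N ->
  exists L c : R, [/\ 1 <= L, 0 < c &
  forall (n : nat) (b : R), L <= b -> b ^+ (r * (4 * r.+1)) = n%:R ->
    (0 < n)%N -> (2 * k <= n)%N ->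
  exists K : {set {set 'I_n}},
  [/\ forall e, e \in K -> #|e| = k,
      forall A : {set {set 'I_n}}, A \subset K -> (0 < #|A|)%N ->
        (#|A| <= 4 * r.+1)%N -> ~~ overdense k r g A,
      sparse (min_tight k r g K) r (L * b) 1
    & c * (n%:R ^+ k * (b / b ^+ (4 * r.+1 * g))) <= #|K|%:R]].
Proof.
move=> r0 g0; pose V := (4 * r.+1)%N; pose C := family_weight R k V.
pose c : R := (2 ^+ k * k`!%:R)^-1.
have C0 : 0 <= C by apply: sumr_ge0 => s _; exact: ler0n.
have f1 : 1 <= 2 ^+ k * k`!%:R :> R.
  rewrite -[leLHS]mul1r; apply: ler_pM; rewrite ?ler01 ?exprn_ege1 ?ler1n ?fact_gt0 //.
have c0 : 0 < c by rewrite invr_gt0 (lt_le_trans ltr01).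
have c1 : c <= 1 by rewrite invf_le1 // (lt_le_trans ltr01).
have r1 : 1 <= r.+1%:R :> R by rewrite ler1n.
(* Chosen so that each error term is at most [c / 4] of [n ^ k * p]: the overdense one gains a
   factor [b >= L], the charge one is divided by [L]. *)
pose L : R := 1 + 4 * C * r.+1%:R / c.
have L1 : 1 <= L by rewrite lerDl divr_ge0 ?mulr_ge0 // ltW.
have L0 : 0 < L by apply: lt_le_trans L1.
have CL : 4 * C * r.+1%:R <= c * L.
  by rewrite /L mulrDr mulr1 [c * (_ / _)]mulrC divfK ?gt_eqF // lerDr ltW.
have ar2 (u v x y z : R) : u <= v -> 4 * v <= x -> x <= y -> y = z -> u <= z / 4 by lra.
have ar3 (x y u v : R) : c * x <= y -> u <= x * (c / 4) -> v <= x * (c / 4) ->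
    c / 2 * x <= y - u - v by lra.
exists L, (c / 2); split=> //; first by rewrite divr_gt0.
move=> n b Lb bn n0 kn.
have b1 : 1 <= b by apply: le_trans Lb.
have b0 : 0 < b by apply: lt_le_trans b1.
set p := b / b ^+ (4 * r.+1 * g).
have p0 : 0 < p by rewrite divr_gt0 ?exprn_gt0.
have p01 (_ : {set 'I_n}) : 0 <= p <= 1.
  rewrite ltW //= /p ler_pdivrMr ?exprn_gt0 // mul1r -[leLHS]expr1 ler_weXn2l //.
  by rewrite muln_gt0 g0.
have [w wE] := expect_attained p01 (sample_value (n := n) k r g V b L).
have [K [Kk Kover Kdeg Kval]] := clean_sample k g (erefl V) b1 L1 w.
exists K; split=> //.
- by move=> e /(subsetP Kk); rewrite inE => /eqP.
- split=> [A /min_tightP[]//|v l].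
  have Lbl : 0 <= (L * b) ^+ l by rewrite exprn_ge0 // mulr_ge0 // ltW.
  have deg0 : deg (min_tight k r g K) v l = 0%N ->
      (deg (min_tight k r g K) v l)%:R <= 'C(r, l)%:R * (L * b) ^+ l * 1 ^+ (r - l) :> R.
    by move=> ->; rewrite expr1n mulr1 mulr_ge0.
  have [l0|l0] := posnP l.
    apply: deg0; apply/eqP; rewrite cards_eq0; apply/eqP/setP => A; rewrite [RHS]inE.
    apply/negbTE/negP; rewrite inE => /and3P[/min_tightP[_ A1 _ _ _] _ /eqP A2].
    by rewrite A2 l0 in A1.
  have [lr|rl] := leqP l r; last first.
    apply: deg0; apply/eqP; rewrite cards_eq0; apply/eqP/setP => A; rewrite [RHS]inE.
    apply/negbTE/negP; rewrite inE => /and3P[/min_tightP[_ _ Ar _ _] _ /eqP A2].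
    by move: Ar; rewrite A2 ltnS leqNgt rl.
  (* As [L >= 1] and [l] is positive, [L * b ^ l] fits under [(L * b) ^ l], the shape of the bounds
     for [M = L * b] and [y = 1]. *)
  apply: le_trans (Kdeg v l) _; rewrite expr1n mulr1 exprMn mulrA.
  rewrite ler_wpM2r ?exprn_ge0 ?(ltW b0) //; apply: (@le_trans _ _ (L ^+ l)).
    by rewrite -[leLHS]expr1 ler_weXn2l.
  by rewrite ler_peMl ?exprn_ge0 ?(ltW L0) // ler1n bin_gt0.
apply: le_trans Kval; apply: le_trans wE.
have := expect_sample_value k g (erefl V) n0 b1 bn L1.
rewrite -/p -/C; apply: le_trans.
set X := n%:R ^+ k * p.
have X0 : 0 < X by rewrite mulr_gt0 // exprn_gt0 // ltr0n.
have E1 : c * X <= 'C(n, k)%:R * p.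
  rewrite mulrA ler_wpM2r ?(ltW p0) // mulrC ler_pdivrMr ?(lt_le_trans ltr01) //.
  by rewrite mulrC -!natrX -!natrM ler_nat expn_leq_bin.
have E2 : n%:R ^+ k / b ^+ (V * g) * C <= X * (c / 4).
  have -> : n%:R ^+ k / b ^+ (V * g) = X / b.
    by rewrite /X /p; field; rewrite !gt_eqF ?exprn_gt0.
  rewrite -mulrA ler_wpM2l ?(ltW X0) // mulrC ler_pdivrMr // mulrAC.
  apply: (ar2 _ (C * r.+1%:R) _ (c * b) _ _ _ _ erefl); first by rewrite ler_peMr.
    by rewrite mulrA; exact: CL.
  by rewrite ler_wpM2l // ltW.
have E3 : X * (r.+1%:R / L) * C <= X * (c / 4).
  rewrite -mulrA ler_wpM2l ?(ltW X0) // mulrAC ler_pdivrMr // mulrAC mulrC.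
  by apply: (ar2 _ (C * r.+1%:R) _ (c * L) _ _ _ _ erefl) => //; rewrite mulrA.
exact: ar3 E1 E2 E3.
Qed.

(** [forces_dense_set] speaks of exactly [m] edges, so a hypergraph with more edges is cut down to
    [m] of them. *)
Lemma BES_gt (k n j i : nat) (I : {set {set 'I_n}}) :
  (forall e, e \in I -> #|e| = k) -> ~~ has_dense_set j i I ->
  (#|I| < BES k n j i)%N.
Proof.
move=> Ik nd; rewrite /BES; case: ex_minnP => m /forallP mP _.
rewrite ltnNge; apply: contra nd => mI.
have [H HI cH] : exists2 H : {set {set 'I_n}}, H \subset I & #|H| = m.
  have : (0 < #|[set A : {set {set 'I_n}} | A \subset I & #|A| == m]|)%N.
    by rewrite cards_draws bin_gt0.
  by case/card_gt0P => A; rewrite inE => /andP[AI /eqP cA]; exists A.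
have := mP H; rewrite cH eqxx andbT => /implyP hH.
have /existsP[S /andP[jS iS]] : has_dense_set j i H.
  by apply: hH; apply/forall_inP => e /(subsetP HI)/Ik ->.
apply/existsP; exists S; rewrite jS.
apply: leq_trans iS _; apply: subset_leq_card; apply/subsetP => e.
by rewrite !inE => /andP[/(subsetP HI) -> ->].
Qed.

(** * Asymptotics *)

From mathcomp Require Import all_classical all_reals all_analysis.
Import numFieldNormedType.Exports.

Lemma cube_expand (R : comPzRingType) (c Y : R) r :
  c * (2 * (2 ^+ r.+3 * Y ^+ r.+2)) ^+ 3 = c * 2 ^+ (3 * r + 12) * Y ^+ (3 * r + 6).
Proof.
have -> : (3 * r + 12 = 3 + r.+3 * 3)%N by lia.
have -> : (3 * r + 6 = r.+2 * 3)%N by lia.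
by rewrite 2!exprMn [in RHS]exprD !exprM !mulrA.
Qed.

Lemma expR_neg_le (R : realType) (x : R) : 0 <= x -> x <= 1 / 2 ->
  expR (- (2 * x)) <= 1 - x.
Proof.
move=> x0 x1; rewrite expRN; apply: (@le_trans _ _ (1 + 2 * x)^-1).
  by rewrite lef_pV2 ?posrE ?expR_gt0 ?expR_ge1Dx //; lra.
rewrite -[leLHS]mul1r ler_pdivrMr; last by lra.
have : x * x <= 1 / 2 * x by rewrite ler_wpM2r.
by lra.
Qed.

(* Iterating the round from y = 1 to y = Y, in N rounds with N polynomial in
   Y, costs a factor at most exp (- 4 r Y ^ r) in M. *)
Lemma nibble (R : realType) (r : nat) : (0 < r)%N -> exists2 Y0 : R, 1 <= Y0 &
  forall (Y M : R) (T : finType) (H : {set {set T}}) (U : {set T}),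
  Y0 <= Y -> expR (8 * r%:R * Y ^+ r) <= M -> no_short_cycle H ->
  sparse H r M 1 -> has_indep_ge H U (Y / (8 * M) * #|U|%:R).
Proof.
move=> r0; pose k := (3 * r + 6)%N.
(* [K * Y ^ k] equals [256 * r * (2 * P) ^ 3] and so dominates [256 * r * N ^ 3], which is what
   [8 * r <= delta ^ 3 * q ^ 2 * m] requires for [delta = 1 / (2 N)] and [q >= 1 / 2]. The threshold
   [Y0] lets the term of order [k + 1] of the exponential series exceed it. *)
pose K : R := 256 * r%:R * 2 ^+ (3 * r + 12).
have r1 : 1 <= r%:R :> R by rewrite ler1n.
have K1 : 1 <= K.
  rewrite /K -[leLHS]mul1r; apply: ler_pM; rewrite ?ler01 ?exprn_ege1 //; last by lra.
  by lra.
have f1 : 1 <= (k.+1)`!%:R :> R by rewrite ler1n fact_gt0.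
exists (2 * K * (k.+1)`!%:R).
  by nra.
move=> Y M T H U Y0Y eM Hc Hs.
have Y2 : 2 <= Y by apply: le_trans Y0Y; nra.
have Y1 : 1 <= Y by lra.
have Yp : 0 < Y by lra.
have Yge0 : 0 <= Y by lra.
(* The number of rounds is dictated by the quadratic loss: with [theta] about [Y / N] and
   [delta = 1 / (2 N)], the bound [2 ^ r * theta ^ 2 * Y ^ r <= q * delta / 2] needs [N] of order
   [2 ^ r * Y ^ (r + 2)]. *)
set P := 2 ^+ r.+3 * Y ^+ r.+2.
have P1 : 1 <= P by rewrite -[leLHS]mul1r; apply: ler_pM; rewrite ?ler01 ?exprn_ege1 //; lra.
pose N := (Num.truncn P).+1.
have NP : P <= N%:R by rewrite ltW // truncnS_gt.
have NP2 : N%:R <= 2 * P.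
  have : (Num.truncn P)%:R <= P by rewrite truncn_le // (le_trans ler01).
  by rewrite /N -natr1; lra.
have N1 : 1 <= N%:R :> R by rewrite ler1n.
have Np : 0 < N%:R :> R by rewrite ltr0n.
pose theta := (Y - 1) / N%:R.
have theta0 : 0 < theta by rewrite divr_gt0 //; lra.
have tge0 : 0 <= theta by exact: ltW.
have thN : theta * N%:R = Y - 1 by rewrite divfK // gt_eqF.
move: theta theta0 tge0 thN => theta theta0 tge0 thN.
have thY : theta * N%:R <= Y by rewrite thN; lra.
have Yr j : 1 <= Y ^+ j by rewrite exprn_ege1.
have rpow : r%:R <= 2 ^+ r :> R by rewrite -natrX ler_nat ltnW // ltn_expl.
have p2 : 1 <= 2 ^+ r :> R by rewrite exprn_ege1 //; lra.
have PE : P = 8 * 2 ^+ r * (Y * Y * Y ^+ r).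
  by rewrite /P -(addn3 r) -(addn2 r) !exprD; ring.
have YY : 1 <= Y * Y by rewrite -[leLHS]mul1r ler_pM.
have YYr : Y ^+ r <= Y * Y * Y ^+ r by rewrite ler_peMl ?exprn_ge0 ?(ltW Yp).
set x := 2 * r%:R * theta * Y ^+ r.-1.
have x0 : 0 <= x by rewrite !mulr_ge0 ?exprn_ge0 ?ler0n.
have xN : x * N%:R <= 2 * r%:R * Y ^+ r.
  rewrite -{2}(prednK r0) exprS /x.
  have -> : 2 * r%:R * theta * Y ^+ r.-1 * N%:R = 2 * r%:R * (theta * N%:R * Y ^+ r.-1) by ring.
  by rewrite ler_wpM2l ?mulr_ge0 ?ler0n // ler_wpM2r ?exprn_ge0 //.
have xhalf : x <= 1 / 2.
  rewrite -(ler_pM2r Np); apply: le_trans xN _.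
  suff : 4 * r%:R * Y ^+ r <= P by lra.
  rewrite PE; have : r%:R * Y ^+ r <= 2 ^+ r * (Y * Y * Y ^+ r) by apply: ler_pM => //; rewrite exprn_ge0 //.
  have : 0 <= 2 ^+ r * (Y * Y * Y ^+ r) by rewrite !mulr_ge0 ?exprn_ge0 //.
  by lra.
pose q := 1 - x.
have q2 : 1 / 2 <= q by rewrite /q; lra.
have q0 : 0 < q by lra.
have qN : expR (- (4 * r%:R * Y ^+ r)) <= q ^+ N.
  apply: (@le_trans _ _ (expR (- (2 * x)) ^+ N)); last first.
    by rewrite lerXn2r ?nnegrE ?expR_ge0 ?(ltW q0) // expR_neg_le.
  by rewrite -expRM_natr ler_expR; lra.
(* All rounds together cost at most half of the exponent [8 * r * Y ^ r] granted to [M]; [m] is the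
   half that remains. *)
pose m := expR (4 * r%:R * Y ^+ r).
have mbig : 256 * r%:R * N%:R ^+ 3 <= m.
  have s1 : 256 * r%:R * N%:R ^+ 3 <= 256 * r%:R * (2 * P) ^+ 3.
    by rewrite ler_wpM2l ?mulr_ge0 ?ler0n // lerXn2r // nnegrE ?ler0n // mulr_ge0 //; lra.
  apply: (le_trans s1).
  have -> : 256 * r%:R * (2 * P) ^+ 3 = K * Y ^+ k by rewrite /P /K cube_expand.
  have := expR_ge1Dxn k (ltW Yp).
  have -> : Y ^+ k.+1 = Y * Y ^+ k by rewrite exprS.
  have e1 : expR Y <= m.
    rewrite ler_expR; apply: (@le_trans _ _ (Y ^+ r)).
      by rewrite -[leLHS]expr1 ler_weXn2l.
    by rewrite ler_peMl ?exprn_ge0 //; lra.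
  move=> e2; apply: le_trans e1; apply: le_trans e2.
  have h : K * Y ^+ k <= Y * Y ^+ k / (k.+1)`!%:R.
    rewrite [leRHS]mulrAC ler_wpM2r ?exprn_ge0 // ler_pdivlMr ?(lt_le_trans ltr01) //.
    by apply: le_trans Y0Y; rewrite -mulrA ler_peMl ?mulr_ge0 // ?(le_trans ler01) //; lra.
  by apply: le_trans h _; rewrite lerDr.
have N3 : N%:R <= N%:R ^+ 3 :> R by rewrite -[leLHS]expr1 ler_weXn2l.
have m256 : 256 * N%:R <= m.
  apply: le_trans mbig; apply: ler_pM => //; lra.
have Mp : 0 < M by apply: lt_le_trans eM; exact: expR_gt0.
have mM : m <= q ^+ N * M.
  apply: le_trans (_ : expR (- (4 * r%:R * Y ^+ r)) * expR (8 * r%:R * Y ^+ r) <= _).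
    by rewrite -expRD ler_expR; lra.
  by apply: ler_pM; rewrite ?expR_ge0.
have thetaPN : theta * P <= Y by apply: le_trans thY; rewrite ler_wpM2l //.
pose delta : R := (2 * N%:R)^-1.
have delta_half : delta * N%:R = 1 / 2 by rewrite /delta; field; rewrite gt_eqF.
have delta0 : 0 < delta by rewrite invr_gt0 mulr_gt0.
have dge0 : 0 <= delta by exact: ltW.
have hS1 : 2 ^+ r * theta * Y ^+ r <= 1 / 2.
  have : 8 * (2 ^+ r * theta * Y ^+ r) * Y <= 1 * Y.
    rewrite mul1r; apply: le_trans thetaPN; rewrite PE.
    have -> : theta * (8 * 2 ^+ r * (Y * Y * Y ^+ r)) = 8 * (2 ^+ r * theta * Y ^+ r) * Y * Y by ring.
    rewrite ler_peMr // !mulr_ge0 ?exprn_ge0 //.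
  rewrite ler_pM2r //; lra.
have theta1 : theta <= 1.
  apply: le_trans (_ : 2 ^+ r * theta * Y ^+ r <= _); last by lra.
  rewrite mulrAC ler_peMl ?(ltW theta0) // -[leLHS]mul1r; exact: ler_pM.
have hS2 : 2 ^+ r * theta ^+ 2 * Y ^+ r <= q * delta / 2.
  apply: (@le_trans _ _ (delta / 4)); last first.
    have : delta * (1 / 2) <= delta * q by rewrite ler_wpM2l.
    by lra.
  rewrite -(ler_pM2r (mulr_gt0 Np Np)).
  have -> : 2 ^+ r * theta ^+ 2 * Y ^+ r * (N%:R * N%:R) = 2 ^+ r * Y ^+ r * ((theta * N%:R) * (theta * N%:R)) by ring.
  have -> : delta / 4 * (N%:R * N%:R) = (delta * N%:R) * N%:R / 4 by ring.
  rewrite delta_half.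
  have : 2 ^+ r * Y ^+ r * (theta * N%:R * (theta * N%:R)) <= 2 ^+ r * Y ^+ r * (Y * Y).
    by rewrite ler_wpM2l ?mulr_ge0 ?exprn_ge0 ?(ltW Yp) // ler_pM // mulr_ge0 ?ler0n.
  have : 8 * (2 ^+ r * Y ^+ r * (Y * Y)) <= N%:R by apply: le_trans NP; rewrite PE; lra.
  by lra.
have hm1 : 8 * r%:R <= delta ^+ 3 * q ^+ 2 * m.
  apply: (@le_trans _ _ (delta ^+ 3 * (1 / 4) * (256 * r%:R * N%:R ^+ 3))); last first.
    apply: ler_pM => //; rewrite ?mulr_ge0 ?exprn_ge0 ?ler0n ?(ltW delta0) //; try lra.
    rewrite ler_wpM2l ?exprn_ge0 ?(ltW delta0) //.
    have : 1 / 2 * (1 / 2) <= q * q by apply: ler_pM; lra.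
    by rewrite expr2; lra.
  have -> : delta ^+ 3 * (1 / 4) * (256 * r%:R * N%:R ^+ 3) = 64 * r%:R * (delta * N%:R) ^+ 3 by field.
  by rewrite delta_half; lra.
have hm2 : 4 <= delta * m.
  apply: (@le_trans _ _ (delta * (256 * N%:R))); last by rewrite ler_wpM2l //.
  by rewrite mulrCA delta_half; lra.
have hm3 : 1 <= q * m.
  by apply: (@le_trans _ _ (1 / 2 * (256 * N%:R))); [lra | apply: ler_pM => //; lra].
have qle : q <= 1 - 2 * r%:R * theta * Y ^+ r.-1 by [].
have YN : 1 + theta *+ N <= Y by rewrite -mulr_natr thN; lra.
have [S [SU HS cS]] := nibble_rounds r0 (ltn0Sn _) theta0 theta1 q0 qle hS1 hS2
  hm1 hm2 hm3 U (leqnn N) mM (lexx 1) YN Hc Hs.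
exists S; split=> //; apply: le_trans cS; rewrite ler_wpM2r //.
(* Since [Y >= 2], [(Y - 1) / (4 * M)] is at least [Y / (8 * M)]. *)
have -> : theta *+ N = Y - 1 by rewrite -thN mulr_natr.
rewrite ler_pdivlMr ?mulr_gt0 //.
have -> : Y / (8 * M) * (4 * M) = Y / 2 by field; rewrite gt_eqF.
lra.
Qed.

(** * Choice of the parameters as functions of [n] *)

Lemma powR_root (R : realType) (x : R) (m : nat) : (0 < m)%N -> 0 <= x ->
  (x `^ (m%:R^-1)) ^+ m = x.
Proof.
move=> m0 x0; rewrite -powR_mulrn ?powR_ge0 // -powRrM mulVf ?powRr1 //.
by rewrite pnatr_eq0 -lt0n.
Qed.

Lemma root_powR (R : realType) (x : R) (m : nat) : (0 < m)%N -> 0 <= x ->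
  (x ^+ m) `^ (m%:R^-1) = x.
Proof.
move=> m0 x0; rewrite -powR_mulrn // -powRrM mulfV ?powRr1 //.
by rewrite pnatr_eq0 -lt0n.
Qed.

Lemma BES_ge (R : realType) (k r g : nat) :
  (0 < r)%N -> (0 < g)%N -> ~~ (r %| g)%N ->
  exists c N0 : R, 0 < c /\ forall n : nat, N0 <= n%:R ->
    c * ((n%:R ^+ (k * r) / n%:R ^+ g * ln n%:R) `^ (r%:R^-1)) <=
    (BES k n (k + g) r.+1)%:R.
Proof.
move=> r0 g0 rg.
have [L [c [L1 c0 sample]]] := sparse_sample R k r0 g0.
have [Y0 Y01 nib] := nibble R r0.
pose V := (4 * r.+1)%N; pose W := (r * V)%N.
have W0 : (0 < W)%N by rewrite muln_gt0 r0.
have rR : 0 < r%:R :> R by rewrite ltr0n.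
have WR : 0 < W%:R :> R by rewrite ltr0n.
have L0 : 0 < L by apply: lt_le_trans L1.
(* [B0 <= b] ensures both [L <= b], for sampling, and [E0 <= M], which is [Y0 <= Y] for the
   nibble. *)
pose E0 := expR (8 * r%:R * Y0 ^+ r); pose B0 := L + E0.
have E00 : 0 < E0 by exact: expR_gt0.
have B00 : 0 <= B0 by rewrite addr_ge0 // ltW.
(* From [ln M >= ln b = ln n / W], the quantity [Y ^ r = ln M / (8 * r)] is at least [q * ln n]. *)
pose q : R := (8 * r%:R * W%:R)^-1.
have q0 : 0 < q by rewrite invr_gt0 !mulr_gt0.
exists (c / (8 * L) * q `^ (r%:R^-1)), (B0 ^+ W + (2 * k).+1%:R).
split; first by rewrite mulr_gt0 ?powR_gt0 // divr_gt0 // mulr_gt0.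
move=> n nN.
have B0W : 0 <= B0 ^+ W by rewrite exprn_ge0.
have kn : (2 * k < n)%N.
  by rewrite -(ler_nat R) (le_trans _ nN) // lerDr.
have n0 : (0 < n)%N by apply: leq_ltn_trans kn.
have nR0 : 0 < n%:R :> R by rewrite ltr0n.
have nR1 : 1 <= n%:R :> R by rewrite ler1n.
pose b : R := n%:R `^ (W%:R^-1).
have bW : b ^+ W = n%:R by rewrite powR_root.
have bge0 : 0 <= b by exact: powR_ge0.
have bB : B0 <= b.
  rewrite -(ler_pXn2r W0) ?nnegrE // bW; apply: le_trans nN.
  by rewrite lerDl.
have Lb : L <= b by apply: le_trans bB; rewrite lerDl ltW.
have b1 : 1 <= b by apply: le_trans Lb.
have b0 : 0 < b by apply: lt_le_trans b1.
have [K [Kk Kover Ksp Kc]] := sample n b Lb bW n0 (ltnW kn).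
pose M := L * b.
have M0 : 0 < M by rewrite mulr_gt0.
have bM : b <= M by rewrite ler_peMl.
have E0M : E0 <= M by apply: le_trans bM; apply: le_trans bB; rewrite lerDr ltW.
have lnM : 8 * r%:R * Y0 ^+ r <= ln M.
  by rewrite -[leLHS]expRK ler_ln ?posrE ?expR_gt0.
(* The largest [Y] with [expR (8 * r * Y ^ r) <= M]. *)
pose Y := (ln M / (8 * r%:R)) `^ (r%:R^-1).
have Y00 : 0 <= Y0 by apply: le_trans Y01.
have lnM0 : 0 <= ln M.
  by apply: le_trans lnM; rewrite !mulr_ge0 ?exprn_ge0 // ltW.
have r8 : 0 < 8 * r%:R :> R by rewrite mulr_gt0.
have YE : Y ^+ r = ln M / (8 * r%:R) by rewrite powR_root // divr_ge0 // ltW.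
have Yge0 : 0 <= Y by exact: powR_ge0.
have Y0Y : Y0 <= Y.
  by rewrite -(ler_pXn2r r0) ?nnegrE // YE ler_pdivlMr // mulrC.
have EM : expR (8 * r%:R * Y ^+ r) <= M.
  by rewrite YE mulrC divfK ?gt_eqF // lnK ?posrE.
have [I [IK HI cI]] := nib Y M _ _ K Y0Y EM (min_tight_no_short_cycle Kover rg) Ksp.
have Ind := indep_min_tight_not_dense Kover rg r0 IK HI.
have Ik e : e \in I -> #|e| = k by move/(fintype.subsetP IK)/Kk.
apply: (@le_trans _ _ #|I|%:R); last by rewrite ler_nat ltnW // BES_gt.
apply: le_trans cI.
pose X := n%:R ^+ k / b ^+ (V * g).
have X0 : 0 <= X by rewrite divr_ge0 ?exprn_ge0 // ltW.
have XE : n%:R ^+ (k * r) / n%:R ^+ g = X ^+ r.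
  rewrite /X expr_div_n -!exprM; congr (_ / _).
  by rewrite -bW -exprM; congr (_ ^+ _); rewrite /W -mulnA mulnC.
have lnn : 0 <= ln (n%:R : R) by rewrite ln_ge0.
rewrite XE powRM ?exprn_ge0 // root_powR //.
have Yge : (q * ln n%:R) `^ (r%:R^-1) <= Y.
  apply: ge0_ler_powR; rewrite ?nnegrE ?invr_ge0 ?(ltW rR) //.
  - by rewrite mulr_ge0 // ltW.
  - by rewrite divr_ge0 // ltW.
  have lnb : ln b = W%:R^-1 * ln n%:R by rewrite ln_powR.
  rewrite ler_pdivlMr // /q; have -> : (8 * r%:R * W%:R)^-1 * ln n%:R * (8 * r%:R) = ln b.
    by rewrite lnb; field; rewrite !gt_eqF.
  by rewrite ler_ln ?posrE.
rewrite powRM ?(ltW q0) // in Yge.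
apply: (@le_trans _ _ (c / (8 * L) * X * Y)).
  rewrite -[leLHS]mulrA -[leRHS]mulrA ler_wpM2l //.
    by rewrite divr_ge0 ?mulr_ge0 // ltW.
  by rewrite [leLHS]mulrCA ler_wpM2l.
(* The surplus factor [b] in the size of [K] cancels against [M = L * b]. *)
have -> : c / (8 * L) * X * Y = Y / (8 * M) * (c * (n%:R ^+ k * (b / b ^+ (V * g)))).
  by rewrite /X /M; field; rewrite !gt_eqF ?exprn_gt0.
by rewrite ler_wpM2l // divr_ge0 // mulr_ge0 // ltW.
Qed.

Local Open Scope classical_set_scope.

Theorem theorem1p8 (R : realType) (i j k : nat)
    (hi0 : (0 < i)%N) (hj0 : (0 < j)%N) (hk : (2 <= k)%N) (hjk : (k < j)%N)
    (hi2 : (2 <= i)%N) (hiC : (i <= 'C(j, k))%N)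
    (hdiv : ~~ (i%:Z - 1 %| k%:Z * i%:Z - j%:Z)%Z) :
  (fun n : nat => (BES k n j i)%:R : R^o) \is 'Omega_\oo
    (fun n : nat =>
       (n%:R ^ (k%:Z * i%:Z - j%:Z) * ln n%:R) `^ (1 / (i%:R - 1)) : R^o).
Proof.
pose r := i.-1; pose g := (j - k)%N.
have ir : i = r.+1 by rewrite prednK.
have jg : j = (k + g)%N by rewrite subnKC // ltnW.
have r0 : (0 < r)%N by move: hi2; rewrite ir.
have g0 : (0 < g)%N by rewrite subn_gt0.
(* In these terms [k * i - j] is [k * r - g], so the hypothesis on [i - 1] says that [r] does not
   divide [g]. *)
have zE : k%:Z * i%:Z - j%:Z = (k * r)%N%:Z - g%:Z by rewrite ir jg; lia.
have iE : i%:Z - 1 = r%:Z by rewrite ir; lia.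
have rg : ~~ (r %| g)%N.
  apply: contra hdiv => rg; rewrite zE iE rpredB // ?dvdzE /=.
  by rewrite dvdn_mull.
have [c [N0 [c0 ge]]] := @BES_ge R k r g r0 g0 rg.
rewrite qualifE; apply/asboolP; exists c => //.
near=> n.
have nN : N0 <= n%:R by near: n; exact: nbhs_infty_ger.
have n1 : 1 <= n%:R :> R by near: n; exact: nbhs_infty_ger.
have nR0 : n%:R != 0 :> R by rewrite gt_eqF // (lt_le_trans ltr01).
rewrite !ger0_norm ?powR_ge0 ?ler0n //; rewrite zE ir jg.
have -> : 1 / (r.+1%:R - 1) = r%:R^-1 :> R by rewrite div1r -natr1 addrK.
have -> : n%:R ^ ((k * r)%N%:Z - g%:Z) = n%:R ^+ (k * r) / n%:R ^+ g :> R.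
  by rewrite expfzDr // exprnN.
exact: ge.
Unshelve. all: by end_near.
Qed.
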